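(* Let $\varphi:\mathbb D\to\mathbb D$ be holomorphic and let $\sigma\in\partial\mathbb D$. Then $\varphi$ is conformal at $\sigma$ in the strong sense if and only if one (and hence both) of the following conditions holds; that is, each of the following conditions is equivalent to conformality of $\varphi$ at $\sigma$ in the strong sense: (b') $\mathrm k_{\mathbb D}(r\sigma,s\sigma)-\mathrm k_{\mathbb D}(\varphi(r\sigma),\varphi(s\sigma))\to0$ as $(0,1)\ni r,s\to1$. (c') $\displaystyle\angle\liminf_{z,w\to\sigma}\frac{|\langle k_z^\varphi,k_w^\varphi\rangle_\varphi|}{\|k_z^\varphi\|_\varphi\,\|k_w^\varphi\|_\varphi}>0$.
   Context: $\mathbb D=\{z\in\mathbb C:|z|<1\}$. The hyperbolic distance is $\mathrm k_{\mathbb D}(z,w)=\log\frac{1+\varrho_{\mathbb D}(z,w)}{1-\varrho_{\mathbb D}(z,w)}$, where $\varrho_{\mathbb D}(z,w)=\left|\frac{z-w}{1-\overline w z}\right|$. For $\sigma\in\partial\mathbb D$ and $M>1$ let $S_M=\{z\in\mathbb D:|z-\sigma|<M(1-|z|)\}$ (Stolz region with vertex $\sigma$). $\angle\lim_{z\to\sigma}f(z)=\ell$ means that for every $M>1$, $f(z)\to\ell$ as $z\to\sigma$ with $z\in S_M$. The inequality $\angle\liminf_{z,w\to\sigma}f(z,w)>0$ means that for every $M>1$ the lower limit of $f(z,w)$ as $z\to\sigma$ and $w\to\sigma$ with $z,w\in S_M$ is positive. For holomorphic $\varphi:\mathbb D\to\mathbb D$, the function $k^\varphi(z,w)=k^\varphi_w(z):=\frac{1-\overline{\varphi(w)}\varphi(z)}{1-\overline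 w z}$, $z,w\in\mathbb D$, is positive definite; the de Branges–Rovnyak space $\mathcal H(\varphi)$ is the unique reproducing kernel Hilbert space of (holomorphic) functions on $\mathbb D$ with reproducing kernel $k^\varphi$, i.e. $k_w^\varphi\in\mathcal H(\varphi)$ and $f(w)=\langle f,k_w^\varphi\rangle_\varphi$ for all $f\in\mathcal H(\varphi)$, $w\in\mathbb D$. Here $\langle\cdot,\cdot\rangle_\varphi$ and $\|\cdot\|_\varphi$ are the inner product and norm of $\mathcal H(\varphi)$. $\varphi$ is called conformal at $\sigma$ in the strong sense if there exists $\omega\in\partial\mathbb D$ such that the angular limit $\angle\lim_{z\to\sigma}\frac{\varphi(z)-\omega}{z-\sigma}$ exists and is finite. *)

(* Defs.v *)
From Stdlib Require Import Reals.
From Coquelicot Require Export Coquelicot.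

Open Scope R_scope.

(* The unit disc appears both as a predicate on C (holomorphic maps, Stolz
   regions) and as a type (domain of the functions in H(phi)). *)

Definition in_disc (z : C) : Prop := Cmod z < 1.

Record unit_disc : Type :=
  mk_unit_disc { disc_pt :> C; disc_ptP : in_disc disc_pt }.

(* phi : C -> C stands for a map on the disc: its values outside the disc are
   irrelevant everywhere below. *)
Definition holomorphic_self_map (phi : C -> C) : Prop :=
  (forall z, in_disc z -> in_disc (phi z)) /\
  (forall z, in_disc z ->
     @ex_derive C_AbsRing C_NormedModule phi z).

Definition pseudo_hyp_dist (z w : C) : R :=
  Cmod ((z - w) / (1 - Cconj w * z))%C.

Definition hyp_dist (z w : C) : R :=
  ln ((1 + pseudo_hyp_dist z w) / (1 - pseudo_hyp_dist z w)).

Definition stolz (sigma : C) (M : R) (z : C) : Prop :=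
  in_disc z /\ Cmod (z - sigma)%C < M * (1 - Cmod z).

Definition stolz_filter (sigma : C) (M : R) : (C -> Prop) -> Prop :=
  within (stolz sigma M) (@locally C_UniformSpace sigma).

Definition is_angular_lim (f : C -> C) (sigma l : C) : Prop :=
  forall M : R, 1 < M ->
    filterlim f (stolz_filter sigma M) (@locally C_UniformSpace l).

(* Lower limit along a filter: the supremum, over the sets V of the filter,
   of the infimum of f on V. *)
Definition filter_liminf {T : Type} (F : (T -> Prop) -> Prop) (f : T -> R)
  : Rbar :=
  Rbar_lub (fun y : Rbar => exists V : T -> Prop,
    F V /\ y = Glb_Rbar (fun t : R => exists x, V x /\ t = f x)).

Definition angular_liminf_gt0 (f : C -> C -> R) (sigma : C) : Prop :=
  forall M : R, 1 < M ->
    Rbar_lt 0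
      (filter_liminf
         (filter_prod (stolz_filter sigma M) (stolz_filter sigma M))
         (fun p : C * C => f (fst p) (snd p))).

(* Only the restriction of [inner] to [carrier] is meaningful. Hermitian
   symmetry makes [inner f f] real, so its real part is its value. *)
Record hilbert_function_space (X : Type) : Type := {
  carrier : (X -> C) -> Prop;
  inner : (X -> C) -> (X -> C) -> C;
  carrier_zero : carrier (fun _ => RtoC 0);
  carrier_plus : forall f g, carrier f -> carrier g ->
    carrier (fun x => f x + g x)%C;
  carrier_scal : forall (a : C) f, carrier f -> carrier (fun x => a * f x)%C;
  inner_plus_l : forall f g h, carrier f -> carrier g -> carrier h ->
    inner (fun x => f x + g x)%C h = (inner f h + inner g h)%C;
  inner_scal_l : forall (a : C) f g, carrier f -> carrier g ->
    inner (fun x => a * f x)%C g = (a * inner f g)%C;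
  inner_conj : forall f g, carrier f -> carrier g ->
    inner g f = Cconj (inner f g);
  inner_ge0 : forall f, carrier f -> 0 <= Re (inner f f);
  inner_eq0 : forall f, carrier f -> inner f f = RtoC 0 ->
    forall x, f x = RtoC 0;
  inner_complete : forall u : nat -> X -> C,
    (forall n, carrier (u n)) ->
    (forall eps : R, 0 < eps -> exists N : nat, forall m n : nat,
       (N <= m)%nat -> (N <= n)%nat ->
       sqrt (Re (inner (fun x => u m x - u n x)%C
                       (fun x => u m x - u n x)%C)) < eps) ->
    exists f, carrier f /\
      is_lim_seq (fun n => sqrt (Re (inner (fun x => u n x - f x)%C
                                           (fun x => u n x - f x)%C))) 0
}.

Arguments carrier {X} _ _.
Arguments inner {X} _ _ _.

Definition hnorm {X : Type} (H : hilbert_function_space X) (f : X -> C) : R :=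
  sqrt (Re (inner H f f)).

(* [k w] is the kernel function at [w], i.e. z |-> k(z,w). *)
Definition is_reproducing_kernel {X : Type} (H : hilbert_function_space X)
    (k : X -> X -> C) : Prop :=
  forall w : X, carrier H (k w) /\
    forall f, carrier H f -> f w = inner H f (k w).

Definition dBR_kernel (phi : C -> C) (w : C) : unit_disc -> C :=
  fun z => ((1 - Cconj (phi w) * phi z) / (1 - Cconj w * z))%C.

(* A reproducing kernel determines its Hilbert space, so this holds for at
   most one space (up to the junk values of [inner] off [carrier]). *)
Definition is_dBR_space (phi : C -> C) (H : hilbert_function_space unit_disc)
  : Prop :=
  is_reproducing_kernel H (fun w : unit_disc => dBR_kernel phi w).

Definition conformal_strong (phi : C -> C) (sigma : C) : Prop :=
  exists omega : C, Cmod omega = 1 /\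
    exists l : C,
      is_angular_lim (fun z => ((phi z - omega) / (z - sigma))%C) sigma l.

(* Main.v *)
Require Import Defs.
From Stdlib Require Import Reals Lra Lia Psatz Classical.
From Coquelicot Require Import Coquelicot.
Open Scope R_scope.

(* All three conditions are equivalent to the boundedness of
   (1 - |phi(r sigma)|) / (1 - r) as r -> 1. That each of them implies it is seen by
   freezing one of the two points. The converses rest on the Julia-Wolff-Carathéodory
   theorem, which only needs the two-point Schwarz-Pick inequality: with
   f = (omega + phi) / (omega - phi), Z = (sigma + z) / (sigma - z) and
   c = inf Re f / Re Z, the map G = f - c Z has Re G >= 0, and Schwarz-Pick for G between
   z and a point z0 where Re G / Re Z is small gives G = o(1 / |sigma - z|) in Stolz
   regions.

   The half-plane Schwarz-Pick inequality is the positivity of a 2 x 2 Herglotz matrix: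
   integrate Re P |h|^2 over a circle, where h combines two Szegő kernels, and use
   Cauchy's formula. Since holomorphy is only pointwise differentiability, Cauchy's
   formula is proved by Goursat's bisection, along the contraction
   zeta + s (e^(i t) - zeta) of the circle to zeta. *)

(** The common currency of the two conditions is the quotient of [sech2] at (z, w) by [sech2] at
    (phi z, phi w), where [sech2] is one minus the squared pseudo-hyperbolic distance. The
    normalised kernel product in (c') is the square root of this quotient, and the difference in
    (b') is small as soon as the quotient is close to 1. With w frozen, the quotient is comparable
    to (1 - |z|) / (1 - |phi z|), so a mere bound on it already controls the radial behaviour of
    [phi]. On the way back, (c') only uses the Lipschitz bound at sigma that conformality contains,
    together with a lower bound for 1 - |phi z|. Condition (b') is finer: the quotient must tend to
    1, which happens because the modulus d of the angular derivative cancels in d * d / d ^ 2. This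
    cancellation requires d to be finite and nonzero. Since d = 1 / c, finiteness is the positivity
    of c, which is Julia's inequality, and d is nonzero because c, an infimum of real numbers
    bounded below, is finite. *)

(* Elements of C are often typed through Coquelicot's structures, which [ring] and
   [field] do not see through. *)
Ltac Cfix :=
  repeat match goal with
  | x : UniformSpace.sort C_UniformSpace |- _ => change C in x
  | x : NormedModule.sort _ C_NormedModule |- _ => change C in x
  end;
  match goal with |- @eq _ ?a ?b => change (@eq C a b) end.
Ltac cring := Cfix; ring.
Ltac cfield := Cfix; field.

(** * Limits and complex differentiability in terms of the modulus *)

Lemma Cmod_ball (x y : C) (eps : R) :
  Cmod (y - x)%C < eps -> @ball C_UniformSpace x eps y.
Proof. exact (C_NormedModule_mixin_compat1 x y eps). Qed.

(** Balls of the product uniform structure on C are squares; [sqrt 2] is the factor that fits such a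
    square into a round disc. *)
Lemma locally_Cmod (z : C) (P : C -> Prop) :
  @locally C_UniformSpace z P <->
  exists d, 0 < d /\ forall w, Cmod (w - z)%C < d -> P w.
Proof.
split.
- intros [d Hd]; exists d; split; [apply cond_pos|].
  intros w Hw; apply Hd, Cmod_ball, Hw.
- intros [d [Hd H]].
  assert (Hs : 0 < sqrt 2) by (apply sqrt_lt_R0; lra).
  assert (Hd' : 0 < d / sqrt 2) by (apply Rdiv_lt_0_compat; lra).
  exists (mkposreal _ Hd'); intros w Hw; apply H.
  generalize (C_NormedModule_mixin_compat2 z w (mkposreal _ Hd') Hw); simpl.
  replace (sqrt 2 * (d / sqrt 2)) with d by (field; lra); exact (fun h => h).
Qed.

Lemma Cconj_RtoC (t : R) : Cconj (RtoC t) = RtoC t.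
Proof. unfold Cconj, RtoC; simpl; f_equal; ring. Qed.

(** Stated for an arbitrary filter, so that one set of limit rules serves neighbourhoods, Stolz
    regions, radii and pairs of radii. *)
Definition climit {T : Type} (F : (T -> Prop) -> Prop) (f : T -> C) (l : C) :=
  forall eps, 0 < eps -> F (fun t => Cmod (f t - l)%C < eps).

Lemma climit_filterlim {T} (F : (T -> Prop) -> Prop) {FF : Filter F} f l :
  climit F f l <-> filterlim f F (@locally C_UniformSpace l).
Proof.
split.
- intros H P HP; apply locally_Cmod in HP; destruct HP as [d [Hd HP]].
  unfold filtermap; apply filter_imp with (2 := H d Hd); intros t Ht; apply HP, Ht.
- intros H eps Heps; apply (H (fun w => Cmod (w - l)%C < eps)).
  apply locally_Cmod; exists eps; split; auto.
Qed.

Section ClimitOps.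
Context {T : Type} {F : (T -> Prop) -> Prop} {FF : Filter F}.

Lemma climit_const c : climit F (fun _ => c) c.
Proof.
intros eps He; apply filter_forall; intros _.
replace (c - c)%C with (RtoC 0) by ring; rewrite Cmod_0; exact He.
Qed.

Lemma climit_ext_loc f g l :
  F (fun t => f t = g t) -> climit F f l -> climit F g l.
Proof.
intros H1 H2 eps He; generalize (filter_and _ _ H1 (H2 eps He)).
apply filter_imp; intros t [-> H]; exact H.
Qed.

Lemma climit_plus f g l m :
  climit F f l -> climit F g m -> climit F (fun t => f t + g t)%C (l + m)%C.
Proof.
intros H1 H2 eps He.
assert (He' : 0 < eps / 2) by lra.
generalize (filter_and _ _ (H1 _ He') (H2 _ He')).
apply filter_imp; intros t [A B].
replace (f t + g t - (l + m))%C with ((f t - l) + (g t - m))%C by ring.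
eapply Rle_lt_trans; [apply Cmod_triangle|lra].
Qed.

Lemma climit_bounded f l :
  climit F f l -> F (fun t => Cmod (f t) < Cmod l + 1).
Proof.
intros H; generalize (H 1 Rlt_0_1); apply filter_imp; intros t Ht.
replace (f t) with (l + (f t - l))%C by ring.
eapply Rle_lt_trans; [apply Cmod_triangle|lra].
Qed.

Lemma climit_mult f g l m :
  climit F f l -> climit F g m -> climit F (fun t => f t * g t)%C (l * m)%C.
Proof.
intros H1 H2 eps He.
set (K := Cmod l + Cmod m + 1).
assert (HK : 0 < K).
{ unfold K; generalize (Cmod_ge_0 l) (Cmod_ge_0 m); lra. }
assert (He' : 0 < eps / (2 * K)) by (apply Rdiv_lt_0_compat; lra).
generalize (filter_and _ _ (climit_bounded f l H1)
  (filter_and _ _ (H1 _ He') (H2 _ He'))).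
apply filter_imp; intros t [A [B D]].
replace (f t * g t - l * m)%C with (f t * (g t - m) + (f t - l) * m)%C by ring.
eapply Rle_lt_trans; [apply Cmod_triangle|]; rewrite 2!Cmod_mult.
assert (E : eps = eps / (2 * K) * K + eps / (2 * K) * K) by (field; lra).
rewrite E.
assert (Cmod (f t) * Cmod (g t - m)%C <= K * (eps / (2 * K))).
{ apply Rmult_le_compat; try apply Cmod_ge_0; unfold K in *;
  generalize (Cmod_ge_0 m); lra. }
assert (Cmod (f t - l)%C * Cmod m < (eps / (2 * K)) * K).
{ apply Rle_lt_trans with (eps / (2 * K) * Cmod m).
  - apply Rmult_le_compat_r; [apply Cmod_ge_0|lra].
  - apply Rmult_lt_compat_l; [lra|]; unfold K; generalize (Cmod_ge_0 l); lra. }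
lra.
Qed.

Lemma climit_opp f l : climit F f l -> climit F (fun t => - f t)%C (- l)%C.
Proof.
intros H eps He; generalize (H eps He); apply filter_imp; intros t Ht.
replace (- f t - - l)%C with (- (f t - l))%C by ring; rewrite Cmod_opp; exact Ht.
Qed.

Lemma climit_minus f g l m :
  climit F f l -> climit F g m -> climit F (fun t => f t - g t)%C (l - m)%C.
Proof. intros H1 H2; apply climit_plus; [exact H1|apply climit_opp, H2]. Qed.

Lemma climit_conj f l :
  climit F f l -> climit F (fun t => Cconj (f t)) (Cconj l).
Proof.
intros H eps He; generalize (H eps He); apply filter_imp; intros t Ht.
rewrite <- Cminus_conj, Cmod_conj; exact Ht.
Qed.

Lemma climit_neq0 f (l : C) : l <> RtoC 0 -> climit F f l ->
  F (fun t => Cmod l / 2 < Cmod (f t)).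
Proof.
intros Hl H; assert (Hm : 0 < Cmod l) by (apply Cmod_gt_0, Hl).
generalize (H (Cmod l / 2) ltac:(lra)); apply filter_imp; intros t Ht.
assert (Cmod l <= Cmod (f t) + Cmod (f t - l)%C); [|lra].
rewrite <- (Cmod_opp (f t - l)%C).
replace l with (f t + - (f t - l))%C at 1 by ring; apply Cmod_triangle.
Qed.

Lemma climit_inv f (l : C) : l <> RtoC 0 -> climit F f l ->
  climit F (fun t => / f t)%C (/ l)%C.
Proof.
intros Hl H eps He; assert (Hm : 0 < Cmod l) by (apply Cmod_gt_0, Hl).
assert (He' : 0 < eps * (Cmod l * Cmod l / 2)).
{ apply Rmult_lt_0_compat; [lra|]; generalize (Rmult_lt_0_compat _ _ Hm Hm); lra. }
generalize (filter_and _ _ (climit_neq0 f l Hl H) (H _ He')).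
apply filter_imp; intros t [A B].
assert (Hf : f t <> RtoC 0) by (apply Cmod_gt_0; lra).
replace (/ f t - / l)%C with (- (f t - l) / (f t * l))%C by (field; auto).
rewrite Cmod_div, Cmod_opp, Cmod_mult by (apply Cmult_neq_0; auto).
apply Rlt_div_l; [apply Rmult_lt_0_compat; lra|].
eapply Rlt_le_trans; [exact B|].
apply Rmult_le_compat_l; [lra|].
generalize (Rmult_le_compat_r (Cmod l) _ _ ltac:(lra) (Rlt_le _ _ A)); lra.
Qed.

Lemma climit_div f g l (m : C) : m <> RtoC 0 -> climit F f l -> climit F g m ->
  climit F (fun t => f t / g t)%C (l / m)%C.
Proof. intros Hm H1 H2; apply climit_mult; [exact H1|apply climit_inv; auto]. Qed.

End ClimitOps.

Lemma climit_id (z : C) : climit (@locally C_UniformSpace z) (fun w => w) z.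
Proof. intros eps He; apply locally_Cmod; exists eps; split; auto. Qed.

Lemma climit_comp {T} (F : (T -> Prop) -> Prop) {FF : Filter F} f g z l :
  climit F f z -> climit (@locally C_UniformSpace z) g l ->
  climit F (fun t => g (f t)) l.
Proof.
intros Hf Hg eps He; generalize (Hg eps He); intros H; apply locally_Cmod in H.
destruct H as [d [Hd H]]; generalize (Hf d Hd); apply filter_imp; intros t Ht.
apply H, Ht.
Qed.

(* Carathéodory's form of differentiability: products, inverses and
   compositions become algebra on the slope [q]. *)
Definition cdiff (f : C -> C) (z : C) :=
  exists q : C -> C,
    @locally C_UniformSpace z (fun w => f w = f z + q w * (w - z))%C /\
    climit (@locally C_UniformSpace z) q (q z).

Lemma cdiff_cont f (z : C) : cdiff f z -> climit (@locally C_UniformSpace z) f (f z).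
Proof.
intros [q [H1 H2]].
apply climit_ext_loc with (fun w => f z + q w * (w - z))%C.
{ revert H1; apply filter_imp; intros w ->; reflexivity. }
replace (f z) with (f z + q z * (z - z))%C at 1 by cring.
apply climit_plus; [apply climit_const|]; apply climit_mult; [exact H2|].
apply climit_minus; [apply climit_id|apply climit_const].
Qed.

Lemma ex_derive_cdiff (f : C -> C) (z : C) :
  @ex_derive C_AbsRing C_NormedModule f z -> cdiff f z.
Proof.
intros [l [_ Hl]].
assert (H := Hl z (fun P HP => HP)); clear Hl.
(* At [w = z] the numerator is 0, so the slope there is [l] whatever value the inverse of 0 has. *)
exists (fun w => l + (f w - f z - l * (w - z)) / (w - z))%C; split.
- apply filter_forall; intros w.
  destruct (Ceq_dec (w - z) 0) as [E|E].
  + rewrite E; replace w with z; [cring|].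
    replace w with (z + (w - z))%C by cring; rewrite E; cring.
  + cfield; exact E.
- intros eps He.
  assert (He' : 0 < eps / 2) by lra.
  generalize (H (mkposreal _ He')); intros [d Hd]; apply locally_Cmod.
  exists d; split; [apply cond_pos|]; intros w Hw.
  replace (l + (f w - f z - l * (w - z)) / (w - z)
    - (l + (f z - f z - l * (z - z)) / (z - z)))%C
    with ((f w - f z - l * (w - z)) / (w - z))%C
    by (unfold Cdiv; cring).
  destruct (Ceq_dec (w - z) 0) as [E|E].
  + rewrite E; replace w with z.
    * replace (f z - f z - l * 0)%C with (RtoC 0) by cring.
      unfold Cdiv; rewrite Cmult_0_l, Cmod_0; exact He.
    * replace w with (z + (w - z))%C by cring; rewrite E; cring.
  + rewrite Cmod_div by exact E.
    assert (Hm : 0 < Cmod (w - z)) by (apply Cmod_gt_0, E).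
    apply Rlt_div_l; [exact Hm|].
    specialize (Hd w).
    apply Rle_lt_trans with (eps / 2 * Cmod (w - z)%C).
    * replace (f w - f z - l * (w - z))%C
        with (minus (minus (f w) (f z)) (scal (minus w z) l)).
      { apply Hd; exact Hw. }
      change (f w + - f z + - ((w + - z) * l) = f w - f z - l * (w - z))%C; cring.
    * apply Rmult_lt_compat_r; lra.
Qed.

Lemma cdiff_const c (z : C) : cdiff (fun _ => c) z.
Proof.
exists (fun _ => RtoC 0); split; [apply filter_forall; intros; cring|].
apply climit_const.
Qed.

Lemma cdiff_id (z : C) : cdiff (fun w => w) z.
Proof.
exists (fun _ => RtoC 1); split; [apply filter_forall; intros; cring|].
apply climit_const.
Qed.

Lemma cdiff_plus f g (z : C) : cdiff f z -> cdiff g z -> cdiff (fun w => f w + g w)%C z.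
Proof.
intros [q [H1 H2]] [p [H3 H4]]; exists (fun w => q w + p w)%C; split.
- generalize (filter_and _ _ H1 H3); apply filter_imp; intros w [-> ->]; cring.
- apply climit_plus; auto.
Qed.

Lemma cdiff_mult f g (z : C) : cdiff f z -> cdiff g z -> cdiff (fun w => f w * g w)%C z.
Proof.
intros Hf Hg; assert (Hc := cdiff_cont g z Hg).
destruct Hf as [q [H1 H2]], Hg as [p [H3 H4]].
exists (fun w => q w * g w + f z * p w)%C; split.
- generalize (filter_and _ _ H1 H3); apply filter_imp; intros w [-> ->]; cring.
- apply climit_plus; apply climit_mult; auto; apply climit_const.
Qed.

Lemma cdiff_opp f (z : C) : cdiff f z -> cdiff (fun w => - f w)%C z.
Proof.
intros [q [H1 H2]]; exists (fun w => - q w)%C; split.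
- revert H1; apply filter_imp; intros w ->; cring.
- apply climit_opp; auto.
Qed.

Lemma cdiff_minus f g (z : C) : cdiff f z -> cdiff g z -> cdiff (fun w => f w - g w)%C z.
Proof. intros H1 H2; apply cdiff_plus; [exact H1|apply cdiff_opp, H2]. Qed.

Lemma cdiff_inv f (z : C) : f z <> RtoC 0 -> cdiff f z -> cdiff (fun w => / f w)%C z.
Proof.
intros Hz Hf; assert (Hc := cdiff_cont f z Hf).
destruct Hf as [q [H1 H2]].
exists (fun w => - q w / (f w * f z))%C; split.
- generalize (filter_and _ _ H1 (climit_neq0 f (f z) Hz Hc)).
  apply filter_imp; intros w [E Hw].
  assert (Hm : 0 < Cmod (f z)) by (apply Cmod_gt_0, Hz).
  assert (Hw' : f w <> RtoC 0) by (apply Cmod_gt_0; lra).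
  replace (- q w / (f w * f z) * (w - z))%C
    with (- (q w * (w - z)) / (f w * f z))%C by (cfield; auto).
  replace (q w * (w - z))%C with (f w - f z)%C by (rewrite E at 1; cring).
  cfield; auto.
- apply climit_div; [apply Cmult_neq_0; auto|apply climit_opp; auto|].
  apply climit_mult; [exact Hc|apply climit_const].
Qed.

Lemma cdiff_div f g (z : C) : g z <> RtoC 0 -> cdiff f z -> cdiff g z ->
  cdiff (fun w => f w / g w)%C z.
Proof. intros Hz H1 H2; apply cdiff_mult; [exact H1|apply cdiff_inv; auto]. Qed.

Lemma cdiff_comp_scal f a (z : C) : cdiff f (a * z)%C -> cdiff (fun w => f (a * w))%C z.
Proof.
intros [q [H1 H2]]; exists (fun w => a * q (a * w))%C.
assert (L : climit (@locally C_UniformSpace z) (fun w => a * w)%C (a * z)%C).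
{ apply climit_mult; [apply climit_const|apply climit_id]. }
split.
- assert (L' := L); apply climit_filterlim in L'; [|apply locally_filter].
  generalize (L' _ H1); unfold filtermap; apply filter_imp; intros w ->; cring.
- apply climit_mult; [apply climit_const|].
  apply climit_comp with (f := fun w => (a * w)%C) (g := q) (z := (a * z)%C); auto.
  apply locally_filter.
Qed.

(** * Goursat's bisection for an abstract rectangle function *)

Lemma nested_intervals (u h : nat -> R) :
  (forall n, 0 <= h n) -> (forall n, u n <= u (S n)) ->
  (forall n, u (S n) + h (S n) <= u n + h n) ->
  exists x, forall n, u n <= x <= u n + h n.
Proof.
intros Hh Hu Hv.
assert (M1 : forall n m, u n <= u (n + m)%nat).
{ intros n m; induction m as [|m IH]; [rewrite Nat.add_0_r; lra|].
  rewrite Nat.add_succ_r; generalize (Hu (n + m)%nat); lra. }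
assert (M2 : forall n m, u (n + m)%nat + h (n + m)%nat <= u n + h n).
{ intros n m; induction m as [|m IH]; [rewrite Nat.add_0_r; lra|].
  rewrite Nat.add_succ_r; generalize (Hv (n + m)%nat); lra. }
assert (M : forall n m, u m <= u n + h n).
{ intros n m; destruct (Nat.le_gt_cases n m) as [L|L].
  - replace m with (n + (m - n))%nat by lia.
    generalize (M2 n (m - n)%nat) (Hh (n + (m - n))%nat); lra.
  - generalize (M1 m (n - m)%nat) (Hh n).
    replace (m + (n - m))%nat with n by lia; lra. }
destruct (completeness (fun x => exists n, x = u n)) as [x [Hx1 Hx2]].
- exists (u 0%nat + h 0%nat); intros x [n ->]; apply M.
- exists (u 0%nat), 0%nat; reflexivity.
- exists x; intros n; split.
  + apply Hx1; exists n; reflexivity.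
  + apply Hx2; intros y [m ->]; apply M.
Qed.

(* The bound [eps * (width + height) ^ 2] is exactly preserved by quartering. *)
Lemma four_quarters (E : R) (a b c d : C) :
  Cmod a <= E -> Cmod b <= E -> Cmod c <= E -> Cmod d <= E ->
  Cmod (a + b + c + d)%C <= 4 * E.
Proof.
intros; generalize (Cmod_triangle (a + b + c)%C d) (Cmod_triangle (a + b)%C c)
  (Cmod_triangle a b); lra.
Qed.

Section Bisection.
Variables (D : R -> R -> R -> R -> C) (a0 c0 h k : R).
Hypotheses (Hh : 0 <= h) (Hk : 0 <= k).
Hypothesis split4 : forall a m b c n d,
  a0 <= a <= m -> m <= b <= a0 + h -> c0 <= c <= n -> n <= d <= c0 + k ->
  D a b c d = (D a m c n + D m b c n + D a m n d + D m b n d)%C.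
Hypothesis local_small : forall x y eps,
  a0 <= x <= a0 + h -> c0 <= y <= c0 + k -> 0 < eps ->
  exists delta, 0 < delta /\ forall a b c d,
    a0 <= a <= x -> x <= b <= a0 + h -> c0 <= c <= y -> y <= d <= c0 + k ->
    b - a < delta -> d - c < delta ->
    Cmod (D a b c d) <= eps * ((b - a) + (d - c)) ^ 2.

Let hn (n : nat) := h / 2 ^ n.
Let kn (n : nat) := k / 2 ^ n.

Let good (eps : R) (n : nat) (p : R * R) :=
  Cmod (D (fst p) (fst p + hn n) (snd p) (snd p + kn n))
    <= eps * (hn n + kn n) ^ 2.

Let good_dec eps n p : {good eps n p} + {~ good eps n p}.
Proof. apply Rle_dec. Defined.

(** The tests select the first quarter that breaks the bound. The fourth quarter is not tested: if
    the parent is bad and three quarters are good, [four_quarters] makes it bad. *)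
Let step (eps : R) (n : nat) (p : R * R) : R * R :=
  let '(a, c) := p in
  if good_dec eps (S n) (a, c) then
    if good_dec eps (S n) (a + hn (S n), c) then
      if good_dec eps (S n) (a, c + kn (S n)) then (a + hn (S n), c + kn (S n))
      else (a, c + kn (S n))
    else (a + hn (S n), c)
  else (a, c).

Let corner (eps : R) := fix corner n :=
  match n with O => (a0, c0) | S n => step eps n (corner n) end.

Let half_pow (t : R) n : t / 2 ^ n = 2 * (t / 2 ^ S n).
Proof. simpl; field; apply pow_nonzero; lra. Qed.

Let pow_ge0 (t : R) n : 0 <= t -> 0 <= t / 2 ^ n.
Proof. intros; apply Rdiv_le_0_compat; [lra|apply pow_lt; lra]. Qed.

(** If the value had modulus m > 0, the whole rectangle would break the quadratic bound for a small
    [eps], some quarter would inherit this at every stage, and the nested quarters would close in on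
    a point where [local_small] says the opposite. *)
Lemma bisection_vanish : D a0 (a0 + h) c0 (c0 + k) = RtoC 0.
Proof.
destruct (Ceq_dec (D a0 (a0 + h) c0 (c0 + k)) 0) as [E|E]; [exact E|exfalso].
apply Cmod_gt_0 in E; set (m := Cmod _) in E.
(* Small enough for the whole rectangle to be bad; the [+ 1] keeps the denominator positive when the
   rectangle is a point. *)
set (eps := m / (2 * ((h + k) ^ 2 + 1))).
assert (Hq : 0 <= (h + k) ^ 2) by apply pow2_ge_0.
assert (He : 0 < eps) by (apply Rdiv_lt_0_compat; lra).
assert (B0 : ~ good eps 0 (a0, c0)).
{ unfold good, hn, kn; simpl fst; simpl snd; simpl pow.
  replace (h / 1) with h by field; replace (k / 1) with k by field; fold m.
  assert (eps * (h + k) ^ 2 < m).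
  { unfold eps; replace m with (m * 1) at 2 by ring.
    unfold Rdiv; rewrite Rmult_assoc; apply Rmult_lt_compat_l; [exact E|].
    rewrite Rmult_comm; apply Rlt_div_l; lra. }
  simpl in H; lra. }
assert (I : forall n, let p := corner eps n in
  ~ good eps n p /\ a0 <= fst p /\ fst p + hn n <= a0 + h /\
  c0 <= snd p /\ snd p + kn n <= c0 + k).
{ induction n as [|n IH]; simpl.
  - split; [exact B0|]; unfold hn, kn; simpl; lra.
  - cbv zeta in IH; destruct (corner eps n) as [a c]; simpl in IH.
    destruct IH as [G IH].
    assert (Hn := half_pow h n); assert (Kn := half_pow k n).
    fold (hn n) (hn (S n)) in Hn; fold (kn n) (kn (S n)) in Kn.
    assert (P1 := pow_ge0 h (S n) Hh); assert (P2 := pow_ge0 k (S n) Hk).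
    fold (hn (S n)) in P1; fold (kn (S n)) in P2.
    unfold step.
    destruct (good_dec eps (S n) (a, c)) as [G1|G1]; [|simpl; split; [exact G1|lra]].
    destruct (good_dec eps (S n) (a + hn (S n), c)) as [G2|G2];
      [|simpl; split; [exact G2|lra]].
    destruct (good_dec eps (S n) (a, c + kn (S n))) as [G3|G3];
      [|simpl; split; [exact G3|lra]].
    simpl; split; [|lra]; intros G4; apply G.
    unfold good in *; simpl fst in *; simpl snd in *.
    rewrite (split4 a (a + hn (S n)) (a + hn n) c (c + kn (S n)) (c + kn n)) by lra.
    replace (a + hn n) with (a + hn (S n) + hn (S n)) by lra.
    replace (c + kn n) with (c + kn (S n) + kn (S n)) by lra.
    replace (eps * (hn n + kn n) ^ 2) with (4 * (eps * (hn (S n) + kn (S n)) ^ 2))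
      by (rewrite Hn, Kn; ring).
    apply four_quarters; assumption. }
assert (St : forall n, let p := corner eps n in let p' := corner eps (S n) in
  fst p <= fst p' /\ fst p' + hn (S n) <= fst p + hn n /\
  snd p <= snd p' /\ snd p' + kn (S n) <= snd p + kn n).
{ intros n; simpl; destruct (corner eps n) as [a c].
  assert (Hn := half_pow h n); assert (Kn := half_pow k n).
  fold (hn n) (hn (S n)) in Hn; fold (kn n) (kn (S n)) in Kn.
  assert (P1 := pow_ge0 h (S n) Hh); assert (P2 := pow_ge0 k (S n) Hk).
  fold (hn (S n)) in P1; fold (kn (S n)) in P2.
  unfold step; repeat (destruct good_dec; simpl; try lra). }
destruct (nested_intervals (fun n => fst (corner eps n)) hn) as [x Hx];
  [intros n; apply pow_ge0, Hh|intros n; apply St|intros n; apply St|].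
destruct (nested_intervals (fun n => snd (corner eps n)) kn) as [y Hy];
  [intros n; apply pow_ge0, Hk|intros n; apply St|intros n; apply St|].
destruct (local_small x y eps) as [delta [Hd L]]; auto.
{ generalize (Hx 0%nat) (I 0%nat); simpl; unfold hn; simpl; lra. }
{ generalize (Hy 0%nat) (I 0%nat); simpl; unfold kn; simpl; lra. }
assert (Z : forall t, 0 <= t -> exists N, forall n, (N <= n)%nat -> t / 2 ^ n < delta).
{ intros t Ht.
  assert (Hl : is_lim_seq (fun n => t * (/ 2) ^ n) (t * 0)).
  { apply (is_lim_seq_scal_l _ t 0); apply is_lim_seq_geom.
    rewrite Rabs_pos_eq; lra. }
  apply is_lim_seq_spec in Hl; destruct (Hl (mkposreal _ Hd)) as [N HN].
  exists N; intros n Hn; specialize (HN n Hn); simpl in HN.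
  rewrite Rmult_0_r, Rminus_0_r, pow_inv in HN.
  apply Rle_lt_trans with (2 := HN); apply Rle_abs. }
destruct (Z h Hh) as [N1 Z1]; destruct (Z k Hk) as [N2 Z2].
set (n := (N1 + N2)%nat).
destruct (I n) as [G J]; apply G; unfold good.
generalize (Hx n) (Hy n); intros Hxn Hyn.
replace (hn n + kn n)
  with ((fst (corner eps n) + hn n - fst (corner eps n))
        + (snd (corner eps n) + kn n - snd (corner eps n))) by ring.
apply L; try lra.
- replace (fst (corner eps n) + hn n - fst (corner eps n)) with (hn n) by ring.
  apply Z1; unfold n; lia.
- replace (snd (corner eps n) + kn n - snd (corner eps n)) with (kn n) by ring.
  apply Z2; unfold n; lia.
Qed.

End Bisection.

(** * Complex-valued integrals over real intervals and the parametrised unit circle *)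

Definition CInt (f : R -> C) (a b : R) : C := @RInt C_R_CompleteNormedModule f a b.
Definition is_CInt (f : R -> C) (a b : R) (l : C) := @is_RInt C_R_NormedModule f a b l.
Definition ccont (f : R -> C) (x : R) := climit (locally x) f (f x).

Lemma ccont_continuous f x : ccont f x <-> @continuous R_UniformSpace C_R_NormedModule f x.
Proof. apply (climit_filterlim (locally x) f (f x)). Qed.

Lemma CInt_correct f a b :
  (forall t, Rmin a b <= t <= Rmax a b -> ccont f t) -> is_CInt f a b (CInt f a b).
Proof.
intros H; apply (@RInt_correct C_R_CompleteNormedModule).
apply (@ex_RInt_continuous C_R_CompleteNormedModule).
intros t Ht; apply ccont_continuous, H, Ht.
Qed.

Lemma is_CInt_unique f a b l : is_CInt f a b l -> CInt f a b = l.
Proof. apply (@is_RInt_unique C_R_CompleteNormedModule). Qed.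

Lemma is_CInt_ext f g a b l :
  (forall t, Rmin a b <= t <= Rmax a b -> f t = g t) -> is_CInt f a b l -> is_CInt g a b l.
Proof. intros H; apply (@is_RInt_ext C_R_NormedModule); intros; apply H; lra. Qed.

Lemma is_CInt_plus f g a b l m : is_CInt f a b l -> is_CInt g a b m ->
  is_CInt (fun t => f t + g t)%C a b (l + m)%C.
Proof. apply (@is_RInt_plus C_R_NormedModule). Qed.

Lemma is_CInt_minus f g a b l m : is_CInt f a b l -> is_CInt g a b m ->
  is_CInt (fun t => f t - g t)%C a b (l - m)%C.
Proof. apply (@is_RInt_minus C_R_NormedModule). Qed.

Lemma is_CInt_Re f a b l : is_CInt f a b l ->
  @is_RInt R_NormedModule (fun t => Re (f t)) a b (Re l).
Proof. apply (@is_RInt_fct_extend_fst R_NormedModule R_NormedModule). Qed.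

Lemma is_CInt_Im f a b l : is_CInt f a b l ->
  @is_RInt R_NormedModule (fun t => Im (f t)) a b (Im l).
Proof. apply (@is_RInt_fct_extend_snd R_NormedModule R_NormedModule). Qed.

Lemma is_CInt_pair f a b l :
  @is_RInt R_NormedModule (fun t => Re (f t)) a b (Re l) ->
  @is_RInt R_NormedModule (fun t => Im (f t)) a b (Im l) -> is_CInt f a b l.
Proof.
intros H1 H2; destruct l as [l1 l2].
exact (@is_RInt_fct_extend_pair R_NormedModule R_NormedModule f a b l1 l2 H1 H2).
Qed.

(** The module structure behind these integrals has real scalars, so a complex factor has to be
    pulled out through real and imaginary parts. *)
Lemma is_CInt_scal c f a b l : is_CInt f a b l -> is_CInt (fun t => c * f t)%C a b (c * l)%C.
Proof.
intros H; assert (H1 := is_CInt_Re _ _ _ _ H); assert (H2 := is_CInt_Im _ _ _ _ H).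
apply is_CInt_pair.
- rewrite re_mult.
  apply is_RInt_ext with (fun t => Re c * Re (f t) - Im c * Im (f t)).
  { intros; rewrite re_mult; reflexivity. }
  apply (@is_RInt_minus R_NormedModule); apply (@is_RInt_scal R_NormedModule); auto.
- rewrite im_mult.
  apply is_RInt_ext with (fun t => Re c * Im (f t) + Im c * Re (f t)).
  { intros; rewrite im_mult; reflexivity. }
  apply (@is_RInt_plus R_NormedModule); apply (@is_RInt_scal R_NormedModule); auto.
Qed.

Lemma is_CInt_conj f a b l : is_CInt f a b l -> is_CInt (fun t => Cconj (f t)) a b (Cconj l).
Proof.
intros H; apply is_CInt_pair.
- apply (is_CInt_Re _ _ _ _ H).
- apply (@is_RInt_opp R_NormedModule); apply (is_CInt_Im _ _ _ _ H).
Qed.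

Lemma is_CInt_Chasles f a b c l m : is_CInt f a b l -> is_CInt f b c m ->
  is_CInt f a c (l + m)%C.
Proof. apply (@is_RInt_Chasles C_R_NormedModule). Qed.

Lemma is_CInt_bound f a b l M : a <= b -> (forall t, a <= t <= b -> Cmod (f t) <= M) ->
  is_CInt f a b l -> Cmod l <= (b - a) * M.
Proof.
intros H1 H2 H3; rewrite Cmod_norm.
apply (@norm_RInt_le_const C_R_NormedModule f a b l M); auto.
intros; rewrite <- Cmod_norm; auto.
Qed.

Lemma is_CInt_const c a b : is_CInt (fun _ => c) a b (RtoC (b - a) * c)%C.
Proof.
replace (RtoC (b - a) * c)%C with (@scal R_AbsRing C_R_NormedModule (b - a) c).
- apply (@is_RInt_const C_R_NormedModule).
- destruct c; unfold Cmult, RtoC; simpl; 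
  change (scal (b - a) (r, r0)) with ((b - a) * r, (b - a) * r0); f_equal; ring.
Qed.

Definition cis (t : R) : C := (cos t, sin t).

Lemma Cmod_le_abs (x y : R) : Cmod (x, y) <= Rabs x + Rabs y.
Proof.
replace (x, y) with (RtoC x + Ci * RtoC y)%C
  by (unfold Cplus, Cmult, RtoC, Ci; simpl; f_equal; ring).
eapply Rle_trans; [apply Cmod_triangle|].
rewrite Cmod_mult, 2!Cmod_R, Cmod_Ci; lra.
Qed.

Lemma Cmod_cis t : Cmod (cis t) = 1.
Proof.
unfold Cmod, cis; simpl fst; simpl snd.
replace (cos t ^ 2 + sin t ^ 2) with 1; [apply sqrt_1|].
generalize (sin2_cos2 t); unfold Rsqr; lra.
Qed.

Lemma cos_lip x y : Rabs (cos x - cos y) <= Rabs (x - y).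
Proof.
destruct (MVT_gen cos y x (fun t => - sin t)) as [c [_ Hc]].
- intros; auto_derive; auto; ring.
- intros; apply continuity_cos.
- rewrite Hc, Rabs_mult, Rabs_Ropp.
  generalize (SIN_bound c) (Rabs_pos (x - y)); intros B P.
  assert (Rabs (sin c) <= 1) by (apply Rabs_le; lra); nra.
Qed.

Lemma sin_lip x y : Rabs (sin x - sin y) <= Rabs (x - y).
Proof.
destruct (MVT_gen sin y x cos) as [c [_ Hc]].
- intros; auto_derive; auto; ring.
- intros; apply continuity_sin.
- rewrite Hc, Rabs_mult.
  generalize (COS_bound c) (Rabs_pos (x - y)); intros B P.
  assert (Rabs (cos c) <= 1) by (apply Rabs_le; lra); nra.
Qed.

Lemma cis_lip x y : Cmod (cis x - cis y)%C <= 2 * Rabs (x - y).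
Proof.
eapply Rle_trans; [apply Cmod_le_abs|].
generalize (cos_lip x y) (sin_lip x y); simpl; unfold Rminus; lra.
Qed.

Lemma locally_R (x : R) (P : R -> Prop) :
  locally x P <-> exists d, 0 < d /\ forall y, Rabs (y - x) < d -> P y.
Proof.
split.
- intros [d H]; exists d; split; [apply cond_pos|exact H].
- intros [d [Hd H]]; exists (mkposreal d Hd); exact H.
Qed.

Lemma ccont_cis t : ccont cis t.
Proof.
intros eps He; apply locally_R; exists (eps / 2); split; [lra|]; intros y Hy.
generalize (cis_lip y t); lra.
Qed.

Lemma ccont_RtoC t : ccont RtoC t.
Proof.
intros eps He; apply locally_R; exists eps; split; [lra|]; intros y Hy.
rewrite <- RtoC_minus, Cmod_R; exact Hy.
Qed.

Lemma is_CInt_cis a b : is_CInt cis a b (- Ci * (cis b - cis a))%C.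
Proof.
apply is_CInt_pair.
- replace (Re (- Ci * (cis b - cis a))%C) with (sin b - sin a) by (simpl; ring).
  apply (is_RInt_derive sin cos); intros; [auto_derive; auto; ring|].
  apply continuity_pt_filterlim, continuity_cos.
- replace (Im (- Ci * (cis b - cis a))%C) with (- cos b - - cos a) by (simpl; ring).
  apply (is_RInt_derive (fun t => - cos t) sin); intros; [auto_derive; auto; ring|].
  apply continuity_pt_filterlim, continuity_sin.
Qed.

Lemma ccont_const c t : ccont (fun _ => c) t.
Proof. apply climit_const. Qed.
Lemma ccont_plus f g t : ccont f t -> ccont g t -> ccont (fun s => f s + g s)%C t.
Proof. apply climit_plus. Qed.
Lemma ccont_minus f g t : ccont f t -> ccont g t -> ccont (fun s => f s - g s)%C t.
Proof. apply climit_minus. Qed.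
Lemma ccont_mult f g t : ccont f t -> ccont g t -> ccont (fun s => f s * g s)%C t.
Proof. apply climit_mult. Qed.
Lemma ccont_div f g t : g t <> RtoC 0 -> ccont f t -> ccont g t ->
  ccont (fun s => f s / g s)%C t.
Proof. apply climit_div. Qed.
Lemma ccont_comp F f t : cdiff F (f t) -> ccont f t -> ccont (fun s => F (f s)) t.
Proof.
intros HF Hf; apply (climit_comp (locally t) f F (f t)); [exact Hf|].
apply cdiff_cont, HF.
Qed.

(** * Cauchy's formula on the unit circle by contraction to a point *)

Section Cauchy.
Variables (F : C -> C) (zeta : C).
Hypothesis HF : forall z, Cmod z <= 1 -> cdiff F z.
Hypothesis Hzeta : Cmod zeta < 1.

Let G (s t : R) : C := (zeta + RtoC s * (cis t - zeta))%C.
Let ker (t : R) : C := (cis t / (cis t - zeta))%C.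

Let cis_zeta t : 1 - Cmod zeta <= Cmod (cis t - zeta)%C.
Proof.
assert (Cmod (cis t) <= Cmod (cis t - zeta)%C + Cmod zeta).
{ replace (cis t) with (cis t - zeta + zeta)%C at 1 by ring; apply Cmod_triangle. }
rewrite Cmod_cis in H; lra.
Qed.

Let cis_zeta_neq t : (cis t - zeta)%C <> RtoC 0.
Proof. apply Cmod_gt_0; generalize (cis_zeta t); lra. Qed.

Let cis_zeta_le t : Cmod (cis t - zeta)%C <= 2.
Proof.
eapply Rle_trans; [apply Cmod_triangle|]; rewrite Cmod_opp, Cmod_cis; lra.
Qed.

Let G_disc s t : 0 <= s <= 1 -> Cmod (G s t) <= 1.
Proof.
intros Hs; unfold G.
replace (zeta + s * (cis t - zeta))%C with (RtoC (1 - s) * zeta + s * cis t)%C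
  by (rewrite RtoC_minus; ring).
eapply Rle_trans; [apply Cmod_triangle|].
rewrite 2!Cmod_mult, 2!Cmod_R, Cmod_cis, 2!Rabs_pos_eq by lra; nra.
Qed.

Let ker_bound t : Cmod (ker t) <= / (1 - Cmod zeta).
Proof.
unfold ker; rewrite Cmod_div, Cmod_cis by auto; unfold Rdiv; rewrite Rmult_1_l.
apply Rinv_le_contravar; [lra|auto].
Qed.

Let ccont_G_theta s t : ccont (G s) t.
Proof.
apply ccont_plus; [apply ccont_const|]; apply ccont_mult; [apply ccont_const|].
apply ccont_minus; [apply ccont_cis|apply ccont_const].
Qed.

Let ccont_G_s s t : ccont (fun s => G s t) s.
Proof.
apply ccont_plus; [apply ccont_const|]; apply ccont_mult; [apply ccont_RtoC|].
apply ccont_const.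
Qed.

Let ccont_ker t : ccont ker t.
Proof.
apply ccont_div; [auto|apply ccont_cis|].
apply ccont_minus; [apply ccont_cis|apply ccont_const].
Qed.

(* The kernel [cis t / (cis t - zeta)] is dG / (G - zeta) along a circle
   s = const, and does not depend on s. [D] is the integral of F dG / (i (G - zeta)) over
   the boundary of the rectangle [a, b] x [c, d] in the (s, t)-plane. *)
Let f1 a b t := ((F (G b t) - F (G a t)) * ker t)%C.
Let f2 c d s := ((F (G s d) - F (G s c)) / RtoC s)%C.
Let D a b c d := (CInt (f1 a b) c d + Ci * CInt (f2 c d) a b)%C.

Let ccont_f1 a b t : 0 <= a <= 1 -> 0 <= b <= 1 -> ccont (f1 a b) t.
Proof.
intros Ha Hb; apply ccont_mult; [|auto]; apply ccont_minus; apply ccont_comp; auto.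
Qed.

Let ccont_f2 c d s : 0 < s <= 1 -> ccont (f2 c d) s.
Proof.
intros Hs; apply ccont_div; [|apply ccont_minus|apply ccont_RtoC].
- intros H; apply RtoC_inj in H; lra.
- apply (ccont_comp F (fun s => G s d)); [apply HF, G_disc; lra|auto].
- apply (ccont_comp F (fun s => G s c)); [apply HF, G_disc; lra|auto].
Qed.

Let int_f1 a b c d : 0 <= a <= 1 -> 0 <= b <= 1 -> is_CInt (f1 a b) c d (CInt (f1 a b) c d).
Proof. intros; apply CInt_correct; auto. Qed.

Let int_f2 a b c d : 0 < a <= b -> b <= 1 -> is_CInt (f2 c d) a b (CInt (f2 c d) a b).
Proof.
intros; apply CInt_correct; intros t; rewrite Rmin_left, Rmax_right by lra.
intros; apply ccont_f2; lra.
Qed.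

(** Each edge integral splits by Chasles, and the increments of [F] inside [f1] and [f2] telescope
    across the inner edges. *)
Let D_split a m b c n d : 0 < a <= m -> m <= b <= 1 -> c <= n <= d ->
  D a b c d = (D a m c n + D m b c n + D a m n d + D m b n d)%C.
Proof.
intros Hm Hb Hc; unfold D.
assert (E1 : forall u v, CInt (f1 a b) u v = (CInt (f1 a m) u v + CInt (f1 m b) u v)%C).
{ intros; apply is_CInt_unique.
  apply is_CInt_ext with (fun t => f1 a m t + f1 m b t)%C.
  - intros; unfold f1; ring.
  - apply is_CInt_plus; apply int_f1; lra. }
assert (E2 : forall u v, 0 < u <= v -> v <= 1 ->
  CInt (f2 c d) u v = (CInt (f2 c n) u v + CInt (f2 n d) u v)%C).
{ intros; apply is_CInt_unique.
  apply is_CInt_ext with (fun t => f2 c n t + f2 n d t)%C.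
  - intros; unfold f2, Cdiv; ring.
  - apply is_CInt_plus; apply int_f2; lra. }
assert (E3 : CInt (f1 a b) c d = (CInt (f1 a b) c n + CInt (f1 a b) n d)%C).
{ apply is_CInt_unique, is_CInt_Chasles with n; apply int_f1; lra. }
assert (E4 : CInt (f2 c d) a b = (CInt (f2 c d) a m + CInt (f2 c d) m b)%C).
{ apply is_CInt_unique, is_CInt_Chasles with m; apply int_f2; lra. }
rewrite E3, E4, !E1, !E2 by lra; ring.
Qed.

Let G_dist s t x y : 0 <= s <= 1 -> 0 <= x <= 1 ->
  Cmod (G s t - G x y)%C <= 2 * (Rabs (s - x) + Rabs (t - y)).
Proof.
intros Hs Hx; unfold G.
replace (zeta + s * (cis t - zeta) - (zeta + x * (cis y - zeta)))%C
  with (RtoC (s - x) * (cis t - zeta) + x * (cis t - cis y))%C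
  by (rewrite RtoC_minus; ring).
eapply Rle_trans; [apply Cmod_triangle|].
rewrite 2!Cmod_mult, 2!Cmod_R, (Rabs_pos_eq x) by lra.
generalize (cis_zeta_le t) (cis_lip t y) (Rabs_pos (s - x)) (Cmod_ge_0 (cis t - cis y)).
nra.
Qed.

(** Replace [F] by its affine approximation at [G x y]. The constant drops out of the increments,
    and the slope contributes [- Ci] and [Ci] times the same product to the two terms of [D], so an
    affine [F] gives exactly 0. What remains is an error of first order on edges whose lengths are
    also of first order. *)
Let D_local s0 x y eps : 0 < s0 -> s0 <= x <= 1 -> 0 < eps ->
  exists delta, 0 < delta /\ forall a b c d,
    s0 <= a <= x -> x <= b <= 1 -> c <= y -> y <= d ->
    b - a < delta -> d - c < delta ->
    Cmod (D a b c d) <= eps * ((b - a) + (d - c)) ^ 2.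
Proof.
intros Hs0 Hx He.
(* [K] collects the bounds of the two kernels, [/ (1 - Cmod zeta)] for [ker] and [/ s0] for [1 / s];
   the 4 in [e] anticipates [Diff], which adds two errors of size [e * (2 * w)]. *)
destruct (HF (G x y)) as [q [Hq1 Hq2]]; [apply G_disc; lra|].
set (K := / (1 - Cmod zeta) + / s0).
assert (K1 : 0 < / (1 - Cmod zeta)) by (apply Rinv_0_lt_compat; lra).
assert (K2 : 0 < / s0) by (apply Rinv_0_lt_compat; lra).
set (e := eps / (4 * K)).
assert (He' : 0 < e) by (apply Rdiv_lt_0_compat; unfold K; lra).
assert (HL0 := @filter_and _ (@locally C_UniformSpace (G x y)) _ _ _ Hq1 (Hq2 _ He')).
destruct (proj1 (locally_Cmod _ _) HL0) as [dl [Hdl HL]].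
(* The image of the rectangle stays within [2 * w] of [z0], and both sides below [dl / 4] give
   [2 * w < dl]. *)
exists (dl / 4); split; [lra|]; intros a b c d Ha Hb Hc Hd Hab Hcd.
set (z0 := G x y) in *.
set (w := (b - a) + (d - c)).
assert (Err : forall s t, a <= s <= b -> c <= t <= d ->
  Cmod (F (G s t) - (F z0 + q z0 * (G s t - z0)))%C <= e * (2 * w)).
{ intros s t Hs Ht.
  assert (Hdist : Cmod (G s t - z0)%C <= 2 * w).
  { eapply Rle_trans; [apply G_dist; lra|].
    assert (Rabs (s - x) <= b - a) by (apply Rabs_le; lra).
    assert (Rabs (t - y) <= d - c) by (apply Rabs_le; lra).
    unfold w; lra. }
  destruct (HL (G s t)) as [-> H2]; [unfold w in Hdist; lra|].
  replace (F z0 + q (G s t) * (G s t - z0) - (F z0 + q z0 * (G s t - z0)))%C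
    with ((q (G s t) - q z0) * (G s t - z0))%C by ring.
  rewrite Cmod_mult; apply Rmult_le_compat; try apply Cmod_ge_0; lra. }
assert (Diff : forall s t s' t', a <= s <= b -> c <= t <= d -> a <= s' <= b -> c <= t' <= d ->
  Cmod (F (G s t) - F (G s' t') - q z0 * (G s t - G s' t'))%C <= e * (4 * w)).
{ intros s t s' t' ? ? ? ?.
  replace (F (G s t) - F (G s' t') - q z0 * (G s t - G s' t'))%C
    with ((F (G s t) - (F z0 + q z0 * (G s t - z0)))
      + - (F (G s' t') - (F z0 + q z0 * (G s' t' - z0))))%C by ring.
  eapply Rle_trans; [apply Cmod_triangle|]; rewrite Cmod_opp.
  generalize (Err s t) (Err s' t'); intros E1 E2.
  specialize (E1 H H0); specialize (E2 H1 H2); lra. }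
assert (R1 : Cmod (CInt (f1 a b) c d - q z0 * RtoC (b - a) * (- Ci * (cis d - cis c)))%C
  <= (d - c) * (e * (4 * w) * / (1 - Cmod zeta))).
{ apply (is_CInt_bound (fun t => f1 a b t - q z0 * RtoC (b - a) * cis t)%C c d); [lra| |].
  - intros t Ht; unfold f1.
    replace ((F (G b t) - F (G a t)) * ker t - q z0 * RtoC (b - a) * cis t)%C
      with ((F (G b t) - F (G a t) - q z0 * (G b t - G a t)) * ker t)%C.
    + rewrite Cmod_mult; apply Rmult_le_compat; try apply Cmod_ge_0; auto.
      apply Diff; lra.
    + unfold ker, G; rewrite RtoC_minus; field; auto.
  - apply is_CInt_minus; [apply int_f1; lra|apply is_CInt_scal, is_CInt_cis]. }
assert (R2 : Cmod (CInt (f2 c d) a b - RtoC (b - a) * (q z0 * (cis d - cis c)))%C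
  <= (b - a) * (e * (4 * w) * / s0)).
{ apply (is_CInt_bound (fun s => f2 c d s - q z0 * (cis d - cis c))%C a b); [lra| |].
  - intros s Hs; unfold f2.
    assert (Hs' : RtoC s <> RtoC 0) by (intros H; apply RtoC_inj in H; lra).
    replace ((F (G s d) - F (G s c)) / s - q z0 * (cis d - cis c))%C
      with ((F (G s d) - F (G s c) - q z0 * (G s d - G s c)) / s)%C
      by (unfold G; field; auto).
    rewrite Cmod_div, Cmod_R, Rabs_pos_eq by (auto; lra).
    apply Rmult_le_compat; [apply Cmod_ge_0| |apply Diff; lra|].
    + apply Rlt_le, Rinv_0_lt_compat; lra.
    + apply Rinv_le_contravar; lra.
  - apply is_CInt_minus; [apply int_f2; lra|apply is_CInt_const]. }
replace (D a b c d)
  with ((CInt (f1 a b) c d - q z0 * RtoC (b - a) * (- Ci * (cis d - cis c)))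
    + Ci * (CInt (f2 c d) a b - RtoC (b - a) * (q z0 * (cis d - cis c))))%C
  by (unfold D; ring).
eapply Rle_trans; [apply Cmod_triangle|]; rewrite Cmod_mult, Cmod_Ci, Rmult_1_l.
assert (Hw : 0 <= e * (4 * w)) by (apply Rmult_le_pos; unfold w; lra).
apply Rle_trans with (w * (e * (4 * w) * K)).
- unfold K; rewrite (Rmult_plus_distr_l (e * (4 * w))), Rmult_plus_distr_l.
  assert (P1 : 0 <= e * (4 * w) * / (1 - Cmod zeta)) by (apply Rmult_le_pos; lra).
  assert (P2 : 0 <= e * (4 * w) * / s0) by (apply Rmult_le_pos; lra).
  apply Rplus_le_compat.
  + eapply Rle_trans; [exact R1|]; apply Rmult_le_compat_r; [lra|unfold w; lra].
  + eapply Rle_trans; [exact R2|]; apply Rmult_le_compat_r; [lra|unfold w; lra].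
- unfold e; right; field; unfold K; lra.
Qed.

Let J s := CInt (fun t => F (G s t) * ker t)%C 0 (2 * PI).

Let int_J s : 0 <= s <= 1 ->
  is_CInt (fun t => F (G s t) * ker t)%C 0 (2 * PI) (J s).
Proof.
intros; apply CInt_correct; intros; apply ccont_mult; [|auto]; apply ccont_comp; auto.
Qed.

(** The edges [t = 0] and [t = 2 * PI] have the same image, so [f2] vanishes between them and the
    vanishing of [D] over [s, 1] x [0, 2 PI] compares the two circles only. Positivity of [s] keeps
    [1 / s] bounded on the rectangle. *)
Let J_const s : 0 < s <= 1 -> J s = J 1.
Proof.
intros Hs; assert (HP := PI_RGT_0).
assert (Z : D s (s + (1 - s)) 0 (0 + 2 * PI) = RtoC 0).
{ apply (bisection_vanish D s 0 (1 - s) (2 * PI)); [lra|lra| |].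
  - intros; apply D_split; lra.
  - intros x y eps Hx _ He.
    destruct (D_local s x y eps) as [dl [Hdl L]]; [lra|lra|auto|].
    exists dl; split; [auto|]; intros; apply L; lra. }
replace (s + (1 - s)) with 1 in Z by ring; rewrite Rplus_0_l in Z.
unfold D in Z.
assert (E2 : CInt (f2 0 (2 * PI)) s 1 = RtoC 0).
{ apply is_CInt_unique; replace (RtoC 0) with (RtoC (1 - s) * RtoC 0)%C by ring.
  apply is_CInt_ext with (fun _ => RtoC 0); [|apply is_CInt_const].
  intros t _; unfold f2, G.
  replace (cis (2 * PI)) with (cis 0)
    by (unfold cis; rewrite cos_2PI, sin_2PI, cos_0, sin_0; reflexivity).
  unfold Cdiv; ring. }
assert (E1 : CInt (f1 s 1) 0 (2 * PI) = (J 1 - J s)%C).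
{ apply is_CInt_unique.
  apply is_CInt_ext with (fun t => F (G 1 t) * ker t - F (G s t) * ker t)%C.
  - intros; unfold f1; ring.
  - apply is_CInt_minus; apply int_J; lra. }
rewrite E1, E2 in Z.
replace (J s) with (J 1 - (J 1 - J s + Ci * RtoC 0))%C by ring.
rewrite Z; ring.
Qed.

Let int_ker : is_CInt ker 0 (2 * PI) (CInt ker 0 (2 * PI)).
Proof. apply CInt_correct; auto. Qed.

(** As [s] tends to 0 the circle shrinks to [zeta] and [F] becomes constant on it, while [ker] does
    not change; since [J s] equals [J 1], the limit is already attained at 1. *)
Let J_lim : J 1 = (F zeta * CInt ker 0 (2 * PI))%C.
Proof.
assert (HP := PI_RGT_0).
assert (K1 : 0 < / (1 - Cmod zeta)) by (apply Rinv_0_lt_compat; lra).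
set (L := (F zeta * CInt ker 0 (2 * PI))%C).
destruct (Ceq_dec (J 1 - L) 0) as [E|E].
{ replace (J 1) with (J 1 - L + L)%C by ring; rewrite E; ring. }
exfalso; apply Cmod_gt_0 in E; set (m := Cmod _) in E.
set (K := 2 * PI * / (1 - Cmod zeta)).
assert (HK : 0 < K) by (apply Rmult_lt_0_compat; lra).
assert (He : 0 < m / (2 * K)) by (apply Rdiv_lt_0_compat; lra).
generalize (cdiff_cont F zeta (HF zeta ltac:(lra)) _ He); intros HL0.
destruct (proj1 (locally_Cmod _ _) HL0) as [dl [Hdl HL]].
set (s := Rmin (dl / 4) 1).
assert (Hs : 0 < s <= 1).
{ unfold s; split; [apply Rmin_glb_lt; lra|apply Rmin_r]. }
assert (Hs' : s <= dl / 4) by apply Rmin_l.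
assert (B : Cmod (J s - L)%C <= (2 * PI - 0) * (m / (2 * K) * / (1 - Cmod zeta))).
{ apply (is_CInt_bound (fun t => F (G s t) * ker t - F zeta * ker t)%C 0 (2 * PI)); [lra| |].
  - intros t _.
    replace (F (G s t) * ker t - F zeta * ker t)%C
      with ((F (G s t) - F zeta) * ker t)%C by ring.
    rewrite Cmod_mult; apply Rmult_le_compat; try apply Cmod_ge_0; auto.
    apply Rlt_le, HL; unfold G.
    replace (zeta + s * (cis t - zeta) - zeta)%C with (s * (cis t - zeta))%C by ring.
    rewrite Cmod_mult, Cmod_R, Rabs_pos_eq by lra.
    generalize (cis_zeta_le t); nra.
  - apply is_CInt_minus; [apply int_J; lra|apply is_CInt_scal, int_ker]. }
rewrite J_const in B by exact Hs; fold m in B.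
replace ((2 * PI - 0) * (m / (2 * K) * / (1 - Cmod zeta))) with (m / 2) in B; [lra|].
unfold K; field; lra.
Qed.

Lemma Cauchy_up_to_constant :
  is_CInt (fun t => F (cis t) * (cis t / (cis t - zeta)))%C 0 (2 * PI)
    (F zeta * CInt (fun t => cis t / (cis t - zeta))%C 0 (2 * PI))%C.
Proof.
change (is_CInt (fun t => F (cis t) * ker t)%C 0 (2 * PI)
  (F zeta * CInt ker 0 (2 * PI))%C).
rewrite <- J_lim.
apply is_CInt_ext with (fun t => F (G 1 t) * ker t)%C; [|apply int_J; lra].
intros t _; unfold G; f_equal; f_equal; ring.
Qed.

End Cauchy.

(** * Szegő kernels and Cauchy's formula as a pairing with them *)

Lemma one_minus_conj_mul_neq0 (a z : C) : Cmod a < 1 -> Cmod z <= 1 ->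
  (1 - Cconj a * z)%C <> RtoC 0.
Proof.
intros Ha Hz H.
assert (E : (Cconj a * z)%C = RtoC 1).
{ replace (Cconj a * z)%C with (1 - (1 - Cconj a * z))%C by ring; rewrite H; ring. }
apply (f_equal Cmod) in E; rewrite Cmod_mult, Cmod_conj, Cmod_1 in E.
generalize (Cmod_ge_0 a) (Cmod_ge_0 z); nra.
Qed.

Definition szego (a z : C) : C := (/ (1 - Cconj a * z))%C.

Lemma cdiff_szego (a z : C) : Cmod a < 1 -> Cmod z <= 1 -> cdiff (szego a) z.
Proof.
intros Ha Hz; apply cdiff_inv; [apply one_minus_conj_mul_neq0; auto|].
apply cdiff_minus; [apply cdiff_const|apply cdiff_mult; [apply cdiff_const|apply cdiff_id]].
Qed.

Lemma Cmod1_conj (z : C) : Cmod z = 1 -> (z * Cconj z)%C = RtoC 1.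
Proof.
intros H; rewrite <- Cmod2_conj, H; f_equal; ring.
Qed.

(** Conjugation inverts the points of the unit circle, which turns the conjugated Szegő kernel into
    the Cauchy kernel. *)
Lemma conj_szego_cis (a : C) t : Cmod a < 1 ->
  Cconj (szego a (cis t)) = (cis t / (cis t - a))%C.
Proof.
intros Ha; unfold szego.
assert (H := Cmod1_conj (cis t) (Cmod_cis t)).
assert (N := one_minus_conj_mul_neq0 a (cis t) Ha ltac:(rewrite Cmod_cis; lra)).
assert (N' : (1 - a * Cconj (cis t))%C <> RtoC 0).
{ intros E; apply N; rewrite <- (Cconj_conj (1 - _)%C).
  rewrite Cminus_conj, Cmult_conj, Cconj_conj.
  rewrite Cconj_RtoC.
  rewrite E; apply Cconj_RtoC. }
rewrite Cinv_conj, Cminus_conj, Cmult_conj, Cconj_conj by exact N.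
rewrite Cconj_RtoC.
assert (E : (cis t - a)%C = (cis t * (1 - a * Cconj (cis t)))%C).
{ replace (cis t * (1 - a * Cconj (cis t)))%C
    with (cis t - a * (cis t * Cconj (cis t)))%C by ring; rewrite H; ring. }
rewrite E; field; split; [exact N'|].
apply Cmod_gt_0; rewrite Cmod_cis; lra.
Qed.

(* The constant left open by [Cauchy_up_to_constant] is 2 PI for a = 0, and the case
   F = szego a evaluated at 0 then gives it for every a. *)
Theorem Cauchy_formula (F : C -> C) (a : C) :
  (forall z, Cmod z <= 1 -> cdiff F z) -> Cmod a < 1 ->
  is_CInt (fun t => F (cis t) * Cconj (szego a (cis t)))%C 0 (2 * PI)
    (RtoC (2 * PI) * F a)%C.
Proof.
intros HF Ha.
assert (H0 : Cmod (RtoC 0) < 1) by (rewrite Cmod_0; lra).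
assert (cis0 : forall t, (cis t / (cis t - RtoC 0))%C = RtoC 1).
{ intros t; field; replace (cis t - RtoC 0)%C with (cis t) by ring.
  apply Cmod_gt_0; rewrite Cmod_cis; lra. }
assert (S0 : szego a 0 = RtoC 1).
{ unfold szego; rewrite Cmult_0_r; field. }
assert (I0 : CInt (fun t => cis t / (cis t - RtoC 0))%C 0 (2 * PI) = RtoC (2 * PI)).
{ apply is_CInt_unique.
  apply is_CInt_ext with (fun _ => RtoC 1); [intros; rewrite cis0; reflexivity|].
  replace (RtoC (2 * PI)) with (RtoC (2 * PI - 0) * 1)%C
    by (rewrite Rminus_0_r; ring).
  apply is_CInt_const. }
assert (M := Cauchy_up_to_constant (szego a) 0
  (fun z Hz => cdiff_szego a z Ha Hz) H0).
rewrite I0, S0, Cmult_1_l in M.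
(* The integral of [szego a] is real, so conjugating it yields the integral of the Cauchy kernel at
   [a] with the same value. *)
assert (M' : is_CInt (fun t => Cconj (szego a (cis t))) 0 (2 * PI) (RtoC (2 * PI))).
{ rewrite <- (Cconj_RtoC (2 * PI)).
  apply is_CInt_conj; revert M; apply is_CInt_ext.
  intros t _; rewrite cis0; ring. }
assert (I1 : CInt (fun t => cis t / (cis t - a))%C 0 (2 * PI) = RtoC (2 * PI)).
{ apply is_CInt_unique; revert M'; apply is_CInt_ext.
  intros t _; apply conj_szego_cis, Ha. }
generalize (Cauchy_up_to_constant F a HF Ha); rewrite I1, Cmult_comm.
apply is_CInt_ext; intros t _; rewrite conj_szego_cis by exact Ha; reflexivity.
Qed.

(** * Herglotz positivity and the two Schwarz-Pick inequalities *)

Lemma climit_Re_ge0 {T} (F : (T -> Prop) -> Prop) {FF : ProperFilter F} f l :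
  climit F f l -> F (fun t => 0 <= Re (f t)) -> 0 <= Re l.
Proof.
intros H1 H2; destruct (Rle_lt_dec 0 (Re l)) as [L|L]; [exact L|exfalso].
destruct (filter_ex _ (filter_and _ _ H2 (H1 (- Re l) ltac:(lra)))) as [t [A B]].
generalize (re_le_Cmod (f t - l)%C) (Rle_abs (Re (f t - l)%C)).
unfold Cminus; rewrite re_plus, re_opp; unfold Cminus in B; lra.
Qed.

(** The conjugate of [h] is a combination of conjugated Szegő kernels, each of which evaluates the
    holomorphic function [P h] at its own point. Hence the integral of [P] times |h|^2 is 2 PI times
    the displayed form. *)
Lemma szego_form_closed (P : C -> C) (z w c : C) :
  (forall u, Cmod u <= 1 -> cdiff P u) -> (forall u, Cmod u <= 1 -> 0 <= Re (P u)) ->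
  Cmod z < 1 -> Cmod w < 1 ->
  let h u := (szego z u + c * szego w u)%C in
  0 <= Re (P z * h z + Cconj c * (P w * h w))%C.
Proof.
intros HP Hre Hz Hw h.
assert (Hh : forall u, Cmod u <= 1 -> cdiff (fun u => P u * h u)%C u).
{ intros u Hu; apply cdiff_mult; [auto|].
  apply cdiff_plus; [apply cdiff_szego; auto|].
  apply cdiff_mult; [apply cdiff_const|apply cdiff_szego; auto]. }
assert (I := is_CInt_plus _ _ _ _ _ _ (Cauchy_formula _ z Hh Hz)
  (is_CInt_scal (Cconj c) _ _ _ _ (Cauchy_formula _ w Hh Hw))).
apply is_CInt_Re in I; apply is_RInt_ge_0 in I.
- replace (RtoC (2 * PI) * (P z * h z) + Cconj c * (RtoC (2 * PI) * (P w * h w)))%C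
    with (RtoC (2 * PI) * (P z * h z + Cconj c * (P w * h w)))%C in I by ring.
  rewrite re_scal_l in I.
  assert (HP0 := PI_RGT_0).
  apply Rmult_le_reg_l with (2 * PI); lra.
- generalize PI_RGT_0; lra.
- intros t _; change C with C_NormedModule.
  replace (P (cis t) * h (cis t) * Cconj (szego z (cis t)) +
    Cconj c * (P (cis t) * h (cis t) * Cconj (szego w (cis t))))%C
    with (P (cis t) * (h (cis t) * Cconj (h (cis t))))%C
    by (unfold h; rewrite Cplus_conj, Cmult_conj; ring).
  rewrite <- Cmod2_conj, re_scal_r; apply Rmult_le_pos; [|apply pow2_ge_0].
  apply Hre; rewrite Cmod_cis; lra.
Qed.

Lemma climit_at_left (f : C -> C) (z : C) : cdiff f z ->
  climit (at_left 1) (fun r => f (RtoC r * z)%C) (f z).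
Proof.
intros H; apply (climit_comp (at_left 1) (fun r => RtoC r * z)%C f z).
- replace z with (RtoC 1 * z)%C at 1 by ring.
  apply climit_mult; [|apply climit_const].
  intros eps He; apply filter_le_within, (ccont_RtoC 1 eps He).
- apply cdiff_cont, H.
Qed.

(** The dilation [P (r u)] with [r < 1] is differentiable on the closed disc; then [r] tends to 1
    with [z], [w] and the kernels kept fixed. *)
Lemma szego_form (P : C -> C) (z w c : C) :
  (forall u, Cmod u < 1 -> cdiff P u) -> (forall u, Cmod u < 1 -> 0 <= Re (P u)) ->
  Cmod z < 1 -> Cmod w < 1 ->
  let h u := (szego z u + c * szego w u)%C in
  0 <= Re (P z * h z + Cconj c * (P w * h w))%C.
Proof.
intros HP Hre Hz Hw h.
apply (climit_Re_ge0 (at_left 1)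
  (fun r => P (RtoC r * z) * h z + Cconj c * (P (RtoC r * w) * h w))%C).
- apply climit_plus; [|apply climit_mult; [apply climit_const|]];
    (apply climit_mult; [apply climit_at_left; auto|apply climit_const]).
- exists (mkposreal 1 Rlt_0_1); intros r Hr Hr1; simpl in Hr.
  assert (H0 : 0 < r).
  { apply Rabs_lt_between in Hr; unfold minus, plus, opp in Hr; simpl in Hr; lra. }
  assert (Hu : forall u, Cmod u <= 1 -> Cmod (RtoC r * u)%C < 1).
  { intros u Hu; rewrite Cmod_mult, Cmod_R, Rabs_pos_eq by lra.
    generalize (Cmod_ge_0 u); nra. }
  apply (szego_form_closed (fun u => P (RtoC r * u)%C)); auto.
  intros u Hu'; apply (cdiff_comp_scal P (RtoC r) u); auto.
Qed.

(** Taking [c = t * Cconj K] aligns the phase and leaves a real quadratic in [t], minimal at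
    [- / (2 * B)]. For [B = 0] it is affine in [t] and bounded below, which forces [K = 0]. *)
Lemma discriminant_ge0 (A B : R) (K : C) : 0 <= B ->
  (forall c : C, 0 <= A + Re (c * K)%C + Cmod c ^ 2 * B) ->
  Cmod K ^ 2 <= 4 * A * B.
Proof.
intros HB H.
assert (Ht : forall t : R, 0 <= A + t * Cmod K ^ 2 + t ^ 2 * Cmod K ^ 2 * B).
{ intros t; specialize (H (RtoC t * Cconj K)%C).
  rewrite Cmod_mult, Cmod_R, Cmod_conj, Rpow_mult_distr, pow2_abs in H.
  replace (t * Cconj K * K)%C with (t * (K * Cconj K))%C in H by ring.
  rewrite <- Cmod2_conj, re_scal_l in H.
  change (Re (RtoC (Cmod K ^ 2))) with (Cmod K ^ 2) in H; exact H. }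
assert (Hk := pow2_ge_0 (Cmod K)); set (k := Cmod K ^ 2) in *.
destruct (Req_dec B 0) as [->|HB'].
- destruct (Req_dec k 0) as [->|Hk']; [lra|].
  specialize (Ht (- (A + 1) / k)).
  replace (- (A + 1) / k * k) with (- (A + 1)) in Ht by (field; auto); lra.
- specialize (Ht (- / (2 * B))).
  replace (A + - / (2 * B) * k + (- / (2 * B)) ^ 2 * k * B)
    with ((4 * A * B - k) / (4 * B)) in Ht by (field; auto).
  assert (0 < 4 * B) by lra.
  apply (Rmult_le_compat_r (4 * B)) in Ht; [|lra].
  replace ((4 * A * B - k) / (4 * B) * (4 * B)) with (4 * A * B - k) in Ht
    by (field; auto); lra.
Qed.

Lemma szego_diag (z : C) : Cmod z < 1 -> szego z z = RtoC (/ (1 - Cmod z ^ 2)).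
Proof.
intros Hz; unfold szego; rewrite Cmult_comm, <- Cmod2_conj, <- RtoC_minus, RtoC_inv;
  [reflexivity|..]; generalize (Cmod_ge_0 z); nra.
Qed.

(** As a form in [c], [szego_form] has diagonal coefficients Re P / (1 - |.|^2) and cross term
    [(P z + Cconj (P w)) * szego w z]; the claim is its discriminant inequality. Nothing is divided
    by Re P, so zeros of Re P are covered. *)
Theorem schwarz_pick_half_plane (P : C -> C) (z w : C) :
  (forall u, Cmod u < 1 -> cdiff P u) -> (forall u, Cmod u < 1 -> 0 <= Re (P u)) ->
  Cmod z < 1 -> Cmod w < 1 ->
  Cmod (P z + Cconj (P w))%C ^ 2 * ((1 - Cmod z ^ 2) * (1 - Cmod w ^ 2))
    <= 4 * Re (P z) * Re (P w) * Cmod (1 - Cconj w * z)%C ^ 2.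
Proof.
intros HP Hre Hz Hw.
assert (Hz' : 0 < 1 - Cmod z ^ 2) by (generalize (Cmod_ge_0 z); nra).
assert (Hw' : 0 < 1 - Cmod w ^ 2) by (generalize (Cmod_ge_0 w); nra).
assert (N : (1 - Cconj w * z)%C <> RtoC 0) by (apply one_minus_conj_mul_neq0; lra).
assert (N' := N); apply Cmod_gt_0 in N'.
assert (D := discriminant_ge0 (Re (P z) * / (1 - Cmod z ^ 2))
  (Re (P w) * / (1 - Cmod w ^ 2)) ((P z + Cconj (P w)) * szego w z)%C).
assert (HD : Cmod ((P z + Cconj (P w)) * szego w z)%C ^ 2
  <= 4 * (Re (P z) * / (1 - Cmod z ^ 2)) * (Re (P w) * / (1 - Cmod w ^ 2))).
{ apply D.
  - apply Rmult_le_pos; [auto|apply Rlt_le, Rinv_0_lt_compat, Hw'].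
  - intros c; generalize (szego_form P z w c HP Hre Hz Hw); cbv beta zeta.
    assert (E : szego z w = Cconj (szego w z)).
    { unfold szego; rewrite Cinv_conj, Cminus_conj, Cmult_conj, Cconj_conj by exact N.
      rewrite Cconj_RtoC.
      do 2 f_equal; ring. }
    replace (P z * (szego z z + c * szego w z)
      + Cconj c * (P w * (szego z w + c * szego w w)))%C
      with (P z * szego z z + (c * Cconj c) * (P w * szego w w)
        + (c * (P z * szego w z) + Cconj (c * (Cconj (P w) * szego w z))))%C
      by (rewrite E, !Cmult_conj, Cconj_conj; ring).
    rewrite !szego_diag, <- Cmod2_conj by assumption.
    rewrite !re_plus, re_conj, re_scal_l, !re_scal_r.
    replace (c * ((P z + Cconj (P w)) * szego w z))%C
      with (c * (P z * szego w z) + c * (Cconj (P w) * szego w z))%C by ring.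
    rewrite re_plus; lra. }
rewrite Cmod_mult, Rpow_mult_distr in HD; unfold szego in HD.
rewrite Cmod_inv, pow_inv in HD by exact N.
set (k := Cmod (P z + Cconj (P w))%C ^ 2) in *.
set (m := Cmod (1 - Cconj w * z)%C) in *.
set (x := 1 - Cmod z ^ 2) in *; set (y := 1 - Cmod w ^ 2) in *.
assert (Hm : 0 < m ^ 2) by (apply pow_lt, N').
apply (Rmult_le_compat_r (m ^ 2 * (x * y))) in HD.
- replace (k * / m ^ 2 * (m ^ 2 * (x * y))) with (k * (x * y)) in HD by (field; lra).
  replace (4 * (Re (P z) * / x) * (Re (P w) * / y) * (m ^ 2 * (x * y)))
    with (4 * Re (P z) * Re (P w) * m ^ 2) in HD by (field; lra).
  exact HD.
- apply Rlt_le; repeat apply Rmult_lt_0_compat; auto; lra.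
Qed.

(** The right-hand side is the Poisson kernel with pole [a]. *)
Lemma Re_cayley (a b : C) : Cmod a = 1 -> (a - b)%C <> RtoC 0 ->
  Re ((a + b) / (a - b))%C = (1 - Cmod b ^ 2) / Cmod (a - b)%C ^ 2.
Proof.
intros Ha Hb; assert (Hb' := Hb); apply Cmod_gt_0 in Hb'.
replace ((a + b) / (a - b))%C
  with ((a + b) * Cconj (a - b) * RtoC (/ Cmod (a - b)%C ^ 2))%C.
- rewrite re_scal_r; unfold Rdiv; f_equal.
  replace (1 - Cmod b ^ 2) with (Cmod a ^ 2 - Cmod b ^ 2) by (rewrite Ha; ring).
  rewrite 2!Cmod2_alt; destruct a, b; simpl; ring.
- rewrite RtoC_inv by (apply pow_nonzero; lra); rewrite Cmod2_conj; field.
  split; [exact Hb|]; intros E; apply (f_equal Cconj) in E.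
  rewrite Cconj_conj in E; apply Hb; rewrite E; apply Cconj_RtoC.
Qed.

Lemma Cmod_lt1_sub_neq0 (a b : C) : Cmod a = 1 -> Cmod b < 1 -> (a - b)%C <> RtoC 0.
Proof.
intros Ha Hb E; assert (a = b) by (replace a with (a - b + b)%C by ring; rewrite E; ring).
subst; lra.
Qed.

(** The polarised form of [Re_cayley]; the 1 in the numerator is [a * Cconj a]. *)
Lemma cayley_sum (a x y : C) : Cmod a = 1 -> (a - x)%C <> RtoC 0 -> (a - y)%C <> RtoC 0 ->
  ((a + x) / (a - x) + Cconj ((a + y) / (a - y)))%C
  = (RtoC 2 * (1 - Cconj y * x) / ((a - x) * Cconj (a - y)))%C.
Proof.
intros Ha Hx Hy.
assert (Hy' : (Cconj a - Cconj y)%C <> RtoC 0).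
{ rewrite <- Cminus_conj; intros E; apply (f_equal Cconj) in E.
  rewrite Cconj_conj in E; apply Hy; rewrite E; apply Cconj_RtoC. }
rewrite Cdiv_conj, Cplus_conj, Cminus_conj by exact Hy.
assert (E := Cmod1_conj a Ha).
replace (RtoC 2 * (1 - Cconj y * x))%C
  with (RtoC 2 * (a * Cconj a - Cconj y * x))%C by (rewrite E; reflexivity).
field; auto.
Qed.

(** The Cayley transform (1 + phi) / (1 - phi) has positive real part, and the powers of |1 - phi|
    produced by [Re_cayley] and [cayley_sum] cancel from the half-plane inequality. *)
Theorem schwarz_pick (phi : C -> C) (z w : C) :
  (forall u, Cmod u < 1 -> cdiff phi u) -> (forall u, Cmod u < 1 -> Cmod (phi u) < 1) ->
  Cmod z < 1 -> Cmod w < 1 ->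
  Cmod (1 - Cconj (phi w) * phi z)%C ^ 2 * ((1 - Cmod z ^ 2) * (1 - Cmod w ^ 2))
    <= (1 - Cmod (phi z) ^ 2) * (1 - Cmod (phi w) ^ 2) * Cmod (1 - Cconj w * z)%C ^ 2.
Proof.
intros Hd Hs Hz Hw.
set (P := fun u => ((RtoC 1 + phi u) / (RtoC 1 - phi u))%C).
assert (N : forall u, Cmod u < 1 -> (RtoC 1 - phi u)%C <> RtoC 0).
{ intros u Hu; apply Cmod_lt1_sub_neq0; [apply Cmod_1|auto]. }
assert (HN : forall u, Cmod u < 1 -> 0 < Cmod (RtoC 1 - phi u)%C ^ 2).
{ intros u Hu; apply pow_lt, Cmod_gt_0, N, Hu. }
assert (HR : forall u, Cmod u < 1 ->
  Re (P u) = (1 - Cmod (phi u) ^ 2) / Cmod (RtoC 1 - phi u)%C ^ 2).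
{ intros u Hu; apply Re_cayley; [apply Cmod_1|auto]. }
assert (S := schwarz_pick_half_plane P z w).
assert (HC : (P z + Cconj (P w))%C =
  (RtoC 2 * (1 - Cconj (phi w) * phi z) / ((RtoC 1 - phi z) * Cconj (RtoC 1 - phi w)))%C).
{ apply cayley_sum; auto; apply Cmod_1. }
rewrite HC, 2!HR in S by assumption.
assert (Nz := HN z Hz); assert (Nw := HN w Hw).
rewrite Cmod_div, 2!Cmod_mult, Cmod_conj, Cmod_R, Rabs_pos_eq in S;
  [|lra|].
- unfold Rdiv in S; rewrite 2!Rpow_mult_distr, pow_inv, Rpow_mult_distr in S.
  set (p := Cmod (RtoC 1 - phi z)%C ^ 2) in *; set (q := Cmod (RtoC 1 - phi w)%C ^ 2) in *.
  apply Rmult_le_reg_l with (4 * / (p * q)).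
  + apply Rmult_lt_0_compat; [lra|]; apply Rinv_0_lt_compat, Rmult_lt_0_compat; auto.
  + refine (Rle_trans _ _ _ (Req_le _ _ _)
      (Rle_trans _ _ _ (S _ _ Hz Hw) (Req_le _ _ _))).
    * field; lra.
    * intros u Hu; apply cdiff_div; [auto|apply cdiff_plus|apply cdiff_minus];
        auto; apply cdiff_const.
    * intros u Hu; rewrite HR by exact Hu; apply Rlt_le, Rdiv_lt_0_compat; [|auto].
      generalize (Hs u Hu) (Cmod_ge_0 (phi u)); nra.
    * field; lra.
- apply Cmult_neq_0; [auto|]; apply Cmod_gt_0; rewrite Cmod_conj.
  apply Cmod_gt_0; auto.
Qed.

(** * Radial boundary value and Julia's inequality *)

Lemma stolz_filter_eps (sigma : C) (M : R) (P : C -> Prop) :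
  stolz_filter sigma M P <->
  exists d, 0 < d /\ forall z, stolz sigma M z -> Cmod (z - sigma)%C < d -> P z.
Proof.
unfold stolz_filter, within; split.
- intros H; destruct (proj1 (locally_Cmod _ _) H) as [d [Hd H']]; exists d; auto.
- intros [d [Hd H]]; apply locally_Cmod; exists d; auto.
Qed.

Lemma climit_stolz_id (sigma : C) M : climit (stolz_filter sigma M) (fun z => z) sigma.
Proof. intros eps He; apply stolz_filter_eps; exists eps; split; auto. Qed.

Lemma is_angular_lim_climit f sigma l : is_angular_lim f sigma l <->
  forall M, 1 < M -> climit (stolz_filter sigma M) f l.
Proof.
split; intros H M HM; apply (climit_filterlim (stolz_filter sigma M)); auto.
Qed.

Lemma one_minus_conj_mul_ge (a b : C) : Cmod a <= 1 -> Cmod b <= 1 ->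
  Cmod (a - b)%C ^ 2 <= Cmod (1 - Cconj a * b)%C ^ 2.
Proof.
intros Ha Hb.
assert (E : Cmod (1 - Cconj a * b)%C ^ 2 - Cmod (a - b)%C ^ 2
  = (1 - Cmod a ^ 2) * (1 - Cmod b ^ 2)).
{ rewrite !Cmod2_alt; destruct a, b; simpl; ring. }
generalize (Cmod_ge_0 a) (Cmod_ge_0 b); intros A B.
assert (0 <= 1 - Cmod a ^ 2) by nra; assert (0 <= 1 - Cmod b ^ 2) by nra.
assert (0 <= (1 - Cmod a ^ 2) * (1 - Cmod b ^ 2)) by (apply Rmult_le_pos; auto).
lra.
Qed.

Lemma Cmod_cauchy_at_left (f : R -> C) :
  (forall eps, 0 < eps -> exists r0, r0 < 1 /\
     forall r s, r0 < r < 1 -> r0 < s < 1 -> Cmod (f r - f s)%C < eps) ->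
  exists l, climit (at_left 1) f l.
Proof.
intros H.
destruct (proj1 (@filterlim_locally_cauchy R
  (CompleteNormedModule.CompleteSpace R_AbsRing C_R_CompleteNormedModule)
  (at_left 1) _ f)) as [l Hl].
- intros eps; destruct (H eps (cond_pos eps)) as [r0 [Hr0 Hr]].
  exists (fun r => r0 < r < 1); split.
  + apply (locally_R 1); exists (1 - r0); split; [lra|].
    intros y Hy Hy1; apply Rabs_def2 in Hy; lra.
  + intros r s Hr' Hs; apply (Cmod_ball (f r) (f s)); auto.
- exists l; apply (climit_filterlim (at_left 1)); exact Hl.
Qed.

Lemma Rabs_Cmod_sub (a b : C) : Rabs (Cmod a - Cmod b) <= Cmod (a - b)%C.
Proof.
generalize (Cmod_triangle (a - b)%C b) (Cmod_triangle a (- (a - b))%C).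
rewrite Cmod_opp; replace (a - b + b)%C with a by ring.
replace (a + - (a - b))%C with b by ring.
intros; apply Rabs_le; lra.
Qed.

Lemma filterlim_Cmod {T} (F : (T -> Prop) -> Prop) {FF : Filter F} f (l : C) :
  climit F f l -> filterlim (fun t => Cmod (f t)) F (locally (Cmod l)).
Proof.
intros H P HP; apply (locally_R (Cmod l)) in HP; destruct HP as [d [Hd HP]].
generalize (H d Hd); unfold filtermap; apply filter_imp; intros t Ht; apply HP.
eapply Rle_lt_trans; [apply Rabs_Cmod_sub|exact Ht].
Qed.

Definition radially_bounded (phi : C -> C) (sigma : C) := exists K r0, 0 <= r0 < 1 /\
  forall r, r0 < r < 1 -> 1 - Cmod (phi (RtoC r * sigma)%C) <= K * (1 - r).

Section Julia.
Variables (phi : C -> C) (sigma : C).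
Hypothesis hphi : holomorphic_self_map phi.
Hypothesis hsigma : Cmod sigma = 1.

Lemma self_map_cdiff u : Cmod u < 1 -> cdiff phi u.
Proof. intros Hu; apply ex_derive_cdiff, hphi, Hu. Qed.

Lemma self_map_lt1 u : Cmod u < 1 -> Cmod (phi u) < 1.
Proof. apply hphi. Qed.

Lemma Cmod_radial r : 0 <= r -> Cmod (RtoC r * sigma)%C = r.
Proof. intros; rewrite Cmod_mult, Cmod_R, hsigma, Rabs_pos_eq; lra. Qed.

Lemma disc_gap (z : C) : Cmod z < 1 -> 1 - Cmod z <= 1 - Cmod z ^ 2 <= 2 * (1 - Cmod z).
Proof. intros Hz; generalize (Cmod_ge_0 z); nra. Qed.

Lemma one_minus_radial r s :
  (1 - Cconj (RtoC s * sigma) * (RtoC r * sigma))%C = RtoC (1 - r * s).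
Proof.
rewrite Cmult_conj; rewrite Cconj_RtoC.
replace (s * Cconj sigma * (r * sigma))%C with (r * s * (sigma * Cconj sigma))%C by ring.
rewrite Cmod1_conj, RtoC_minus, RtoC_mult by exact hsigma; ring.
Qed.

(** Both points are compared with [sigma], writing 1 as [sigma * Cconj sigma]. Near [sigma] this
    controls the denominator in Schwarz-Pick by distances to the boundary point. *)
Lemma one_minus_bound (a b : C) : Cmod a <= 1 ->
  Cmod (1 - Cconj a * b)%C <= Cmod (sigma - a)%C + Cmod (sigma - b)%C.
Proof.
intros Ha.
replace (1 - Cconj a * b)%C
  with (Cconj (sigma - a) * sigma + Cconj a * (sigma - b))%C.
- eapply Rle_trans; [apply Cmod_triangle|].
  rewrite !Cmod_mult, !Cmod_conj, hsigma; generalize (Cmod_ge_0 (sigma - b)%C); nra.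
- rewrite Cminus_conj; generalize (Cmod1_conj sigma hsigma); intros E.
  replace ((Cconj sigma - Cconj a) * sigma + Cconj a * (sigma - b))%C
    with (sigma * Cconj sigma - Cconj a * b)%C by ring.
  rewrite E; reflexivity.
Qed.

(** In Schwarz-Pick against [r * sigma] both sides contain a factor vanishing as [r] tends to 1: 1 -
    r^2 on the left and 1 - |phi|^2, at most 2 K (1 - r), on the right. Dividing by 1 - r leaves an
    inequality that survives the limit. *)
Lemma radial_julia K r0 : 0 <= r0 < 1 -> 
  (forall r, r0 < r < 1 -> 1 - Cmod (phi (RtoC r * sigma)%C) <= K * (1 - r)) ->
  forall z r, Cmod z < 1 -> r0 < r < 1 ->
  Cmod (1 - Cconj (phi (RtoC r * sigma)) * phi z)%C ^ 2 * (1 - Cmod z ^ 2)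
    <= 2 * K * (1 - Cmod (phi z) ^ 2) * Cmod (1 - Cconj (RtoC r * sigma) * z)%C ^ 2.
Proof.
intros Hr0 HK z r Hz Hr.
set (w := (RtoC r * sigma)%C).
assert (Hw : Cmod w = r) by (apply Cmod_radial; lra).
assert (Hw1 : Cmod w < 1) by lra.
generalize (schwarz_pick phi z w self_map_cdiff self_map_lt1 Hz Hw1); intros S.
rewrite Hw in S.
assert (G := disc_gap (phi w) (self_map_lt1 w Hw1)).
assert (G' := disc_gap (phi z) (self_map_lt1 z Hz)).
assert (Pz := self_map_lt1 z Hz).
specialize (HK r Hr); fold w in HK.
set (A := Cmod (1 - Cconj (phi w) * phi z)%C ^ 2 * (1 - Cmod z ^ 2)) in *.
set (B := Cmod (1 - Cconj w * z)%C ^ 2) in *.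
assert (HB : 0 <= B) by apply pow2_ge_0.
assert (HA : 0 <= A).
{ apply Rmult_le_pos; [apply pow2_ge_0|generalize (disc_gap z Hz); lra]. }
apply Rmult_le_reg_r with (1 - r); [lra|].
apply Rle_trans with (A * (1 - r ^ 2)).
{ apply Rmult_le_compat_l; [exact HA|nra]. }
replace (A * (1 - r ^ 2))
  with (Cmod (1 - Cconj (phi w) * phi z)%C ^ 2 * ((1 - Cmod z ^ 2) * (1 - r ^ 2)))
  by (unfold A; ring).
eapply Rle_trans; [exact S|].
replace (2 * K * (1 - Cmod (phi z) ^ 2) * B * (1 - r))
  with ((1 - Cmod (phi z) ^ 2) * (2 * (K * (1 - r))) * B) by ring.
apply Rmult_le_compat_r; [exact HB|]; apply Rmult_le_compat_l; lra.
Qed.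

(** Between two radial points [radial_julia] gives |phi (r sigma) - phi (s sigma)| <= 2 K (1 - r s),
    so the radial values are Cauchy; the bound on 1 - |phi| puts their limit on the unit circle. *)
Lemma radial_boundary_value K r0 : 0 <= r0 < 1 ->
  (forall r, r0 < r < 1 -> 1 - Cmod (phi (RtoC r * sigma)%C) <= K * (1 - r)) ->
  exists omega, Cmod omega = 1 /\
    climit (at_left 1) (fun r => phi (RtoC r * sigma)%C) omega.
Proof.
intros Hr0 HK.
assert (Lt : forall r, r0 < r < 1 -> Cmod (RtoC r * sigma)%C < 1).
{ intros r Hr; rewrite Cmod_radial; lra. }
assert (HK0 : 0 < K).
{ specialize (HK ((r0 + 1) / 2) ltac:(lra)).
  generalize (self_map_lt1 _ (Lt ((r0 + 1) / 2) ltac:(lra))); intros; nra. }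
assert (L : forall r s, r0 < r < 1 -> r0 < s < 1 ->
  Cmod (phi (RtoC r * sigma) - phi (RtoC s * sigma))%C <= 2 * K * (1 - r * s)).
{ intros r s Hr Hs.
  assert (J := radial_julia K r0 Hr0 HK (RtoC s * sigma)%C r (Lt s Hs) Hr).
  rewrite one_minus_radial, Cmod_R, pow2_abs, Cmod_radial in J by lra.
  assert (G := disc_gap _ (self_map_lt1 _ (Lt s Hs))); specialize (HK s Hs).
  assert (O := one_minus_conj_mul_ge (phi (RtoC r * sigma)%C) (phi (RtoC s * sigma)%C)
    (Rlt_le _ _ (self_map_lt1 _ (Lt r Hr))) (Rlt_le _ _ (self_map_lt1 _ (Lt s Hs)))).
  set (D := Cmod (phi (RtoC r * sigma) - phi (RtoC s * sigma))%C) in *.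
  set (B := Cmod (1 - Cconj (phi (RtoC r * sigma)) * phi (RtoC s * sigma))%C ^ 2) in *.
  apply Rsqr_incr_0_var; [unfold Rsqr|apply Rmult_le_pos; nra].
  assert (Hs' : 0 < 1 - s) by lra.
  apply Rmult_le_reg_r with (1 - s); [lra|].
  apply Rle_trans with (B * (1 - s ^ 2)).
  { assert (0 <= B) by apply pow2_ge_0.
    apply Rle_trans with (B * (1 - s)).
    - apply Rmult_le_compat_r; lra.
    - apply Rmult_le_compat_l; nra. }
  eapply Rle_trans; [exact J|].
  replace (2 * K * (1 - r * s) * (2 * K * (1 - r * s)) * (1 - s))
    with (2 * K * (2 * (K * (1 - s))) * (1 - s * r) ^ 2) by ring.
  apply Rmult_le_compat_r; [apply pow2_ge_0|].
  apply Rmult_le_compat_l; lra. }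
destruct (Cmod_cauchy_at_left (fun r => phi (RtoC r * sigma)%C)) as [omega Ho].
(* With e = eps / (4 K + 1), radii beyond 1 - e have 1 - r s at most 2 e, and 2 K times this is
   below eps. *)
{ intros eps He; exists (Rmax r0 (1 - eps / (4 * K + 1))).
  assert (E0 : 0 < eps / (4 * K + 1)) by (apply Rdiv_lt_0_compat; lra).
  split; [apply Rmax_lub_lt; lra|].
  intros r s Hr Hs.
  generalize (Rmax_l r0 (1 - eps / (4 * K + 1))) (Rmax_r r0 (1 - eps / (4 * K + 1))).
  set (e := eps / (4 * K + 1)) in *; intros.
  eapply Rle_lt_trans; [apply L; lra|].
  assert (1 - r * s <= 2 * e) by nra.
  apply Rle_lt_trans with (2 * K * (2 * e)); [apply Rmult_le_compat_l; lra|].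
  replace eps with (e * (4 * K + 1)) by (unfold e; field; lra); nra. }
exists omega; split; [|exact Ho].
assert (Ho' := filterlim_Cmod _ _ _ Ho).
assert (L1 : filterlim (fun r => Cmod (phi (RtoC r * sigma)%C)) (at_left 1) (locally 1)).
{ intros P HP; apply (locally_R 1) in HP; destruct HP as [d [Hd HP]].
  apply (locally_R 1); exists (Rmin (1 - r0) (d / (K + 1))).
  assert (E0 : 0 < d / (K + 1)) by (apply Rdiv_lt_0_compat; lra).
  split; [apply Rmin_glb_lt; lra|].
  intros r Hr Hr1; apply Rabs_def2 in Hr.
  generalize (Rmin_l (1 - r0) (d / (K + 1))) (Rmin_r (1 - r0) (d / (K + 1))); intros.
  assert (r0 < r < 1) by lra.
  apply HP; generalize (HK r H1) (self_map_lt1 _ (Lt r H1)); intros.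
  set (e := d / (K + 1)) in *.
  assert (d = e * (K + 1)) by (unfold e; field; lra).
  apply Rabs_lt_between; nra. }
apply (filterlim_locally_unique (F := at_left 1) _ _ _ Ho' L1).
Qed.

(** The limit of [radial_julia] as [r] tends to 1, where |1 - conj a b| becomes |a - b| because [a]
    reaches the unit circle. *)
Lemma julia K r0 omega : 0 <= r0 < 1 -> Cmod omega = 1 ->
  (forall r, r0 < r < 1 -> 1 - Cmod (phi (RtoC r * sigma)%C) <= K * (1 - r)) ->
  climit (at_left 1) (fun r => phi (RtoC r * sigma)%C) omega ->
  forall z, Cmod z < 1 ->
  Cmod (omega - phi z)%C ^ 2 * (1 - Cmod z ^ 2)
    <= 2 * K * (1 - Cmod (phi z) ^ 2) * Cmod (sigma - z)%C ^ 2.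
Proof.
intros Hr0 Ho1 HK Ho z Hz.
assert (T : forall a b : C, Cmod a = 1 -> Cmod (1 - Cconj a * b)%C = Cmod (a - b)%C).
{ intros a b Ha; replace (a - b)%C with (a * (1 - Cconj a * b))%C.
  - rewrite Cmod_mult, Ha; ring.
  - replace (a * (1 - Cconj a * b))%C with (a - (a * Cconj a) * b)%C by ring.
    rewrite Cmod1_conj by exact Ha; ring. }
rewrite <- (T omega), <- (T sigma) by assumption.
assert (L1 : climit (at_left 1) (fun r => 1 - Cconj (phi (RtoC r * sigma)) * phi z)%C
  (1 - Cconj omega * phi z)%C).
{ apply climit_minus; [apply climit_const|]; apply climit_mult; [|apply climit_const].
  apply climit_conj, Ho. }
assert (L2 : climit (at_left 1) (fun r => 1 - Cconj (RtoC r * sigma) * z)%C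
  (1 - Cconj sigma * z)%C).
{ apply climit_minus; [apply climit_const|]; apply climit_mult; [|apply climit_const].
  apply climit_conj, (climit_at_left (fun u => u)), cdiff_id. }
assert (S : forall f l, climit (at_left 1) f l ->
  filterlim (fun r => Cmod (f r) ^ 2) (at_left 1) (locally (Cmod l ^ 2))).
{ intros f l H; apply filterlim_Cmod in H; [|apply at_left_proper_filter].
  apply (filterlim_comp _ _ _ _ (fun x => x ^ 2) _ (locally (Cmod l))); [exact H|].
  apply (continuous_comp (fun x => x) (fun x => x ^ 2)); [apply continuous_id|].
  apply (ex_derive_continuous (fun x : R => x ^ 2)); auto_derive; auto. }
assert (S1 := S _ _ L1); assert (S2 := S _ _ L2).
refine (@filterlim_le R (at_left 1) _
  (fun r => Cmod (1 - Cconj (phi (RtoC r * sigma)) * phi z)%C ^ 2 * (1 - Cmod z ^ 2))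
  (fun r => 2 * K * (1 - Cmod (phi z) ^ 2) * Cmod (1 - Cconj (RtoC r * sigma) * z)%C ^ 2)
  (Finite _) (Finite _) _ _ _).
- apply (locally_R 1); exists (1 - r0); split; [lra|].
  intros r Hr Hr1; apply Rabs_def2 in Hr; apply (radial_julia K r0); auto; lra.
- apply (filterlim_comp _ _ _ _ (fun x => x * (1 - Cmod z ^ 2)) _ _ _ S1).
  apply (ex_derive_continuous (fun x : R => x * (1 - Cmod z ^ 2))); auto_derive; auto.
- apply (filterlim_comp _ _ _ _ (fun x => 2 * K * (1 - Cmod (phi z) ^ 2) * x) _ _ _ S2).
  apply (ex_derive_continuous (fun x : R => 2 * K * (1 - Cmod (phi z) ^ 2) * x)).
  auto_derive; auto.
Qed.

End Julia.

(** * The Julia-Wolff-Carathéodory theorem *)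

Lemma disc_pt0 : Cmod (RtoC 0) < 1.
Proof. rewrite Cmod_0; lra. Qed.

(** The infimum may not be attained, so it comes with near-minimisers; these supply the point z0 of
    the Schwarz-Pick comparison. *)
Lemma glb_approx (u : C -> R) (m : R) : (forall z, Cmod z < 1 -> m <= u z) ->
  exists c, m <= c /\ (forall z, Cmod z < 1 -> c <= u z) /\
    forall eta, 0 < eta -> exists z, Cmod z < 1 /\ u z < c + eta.
Proof.
intros H.
destruct (completeness (fun y => exists z, Cmod z < 1 /\ y = - u z)) as [l [Hl1 Hl2]].
- exists (- m); intros y [z [Hz ->]]; specialize (H z Hz); lra.
- exists (- u (RtoC 0)), (RtoC 0); split; [apply disc_pt0|reflexivity].
- assert (HL : forall z, Cmod z < 1 -> - l <= u z).
  { intros z Hz; assert (- u z <= l) by (apply Hl1; exists z; auto); lra. }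
  exists (- l); split; [|split; [exact HL|]].
  + assert (l <= - m); [|lra].
    apply Hl2; intros y [z [Hz ->]]; specialize (H z Hz); lra.
  + intros eta He.
    destruct (classic (exists z, Cmod z < 1 /\ u z < - l + eta)) as [E|E]; [exact E|].
    exfalso; assert (l <= l - eta); [|lra].
    apply Hl2; intros y [z [Hz ->]].
    apply Rnot_lt_le; intros L; apply E; exists z; split; [exact Hz|lra].
Qed.

Section AngularDerivative.
Variables (phi : C -> C) (sigma omega : C) (c : R).
Hypothesis hphi : holomorphic_self_map phi.
Hypothesis hsigma : Cmod sigma = 1.
Hypothesis homega : Cmod omega = 1.

Let Gf (z : C) : C :=
  ((omega + phi z) / (omega - phi z) - RtoC c * ((sigma + z) / (sigma - z)))%C.
(** Re f / Re Z, the quotient of the two Poisson kernels that [Re_cayley] gives for [phi z] at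
    [omega] and for [z] at [sigma]. *)
Let ratio (z : C) : R :=
  (1 - Cmod (phi z) ^ 2) * Cmod (sigma - z)%C ^ 2
  / (Cmod (omega - phi z)%C ^ 2 * (1 - Cmod z ^ 2)).

Hypothesis hc_le : forall z, Cmod z < 1 -> c <= ratio z.
Hypothesis hc_approx : forall eta, 0 < eta ->
  exists z, Cmod z < 1 /\ ratio z < c + eta.

Let Nphi z : Cmod z < 1 -> (omega - phi z)%C <> RtoC 0.
Proof. intros Hz; apply Cmod_lt1_sub_neq0; [exact homega|apply hphi, Hz]. Qed.

Let Nz z : Cmod z < 1 -> (sigma - z)%C <> RtoC 0.
Proof. intros Hz; apply Cmod_lt1_sub_neq0; auto. Qed.

Let gap z : Cmod z < 1 -> 0 < 1 - Cmod z ^ 2.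
Proof. intros Hz; generalize (disc_gap z Hz); lra. Qed.

Let Re_Gf z : Cmod z < 1 ->
  Re (Gf z) = (ratio z - c) * ((1 - Cmod z ^ 2) / Cmod (sigma - z)%C ^ 2).
Proof.
intros Hz; unfold Gf, Cminus at 1; rewrite re_plus, re_opp, re_scal_l.
rewrite !Re_cayley; auto; unfold ratio.
assert (A := Nphi z Hz); assert (B := Nz z Hz); apply Cmod_gt_0 in A, B.
generalize (gap z Hz); intros; field; repeat split; lra.
Qed.

(* Schwarz-Pick between z and z0, divided by |G z + conj (G z0)| >= Re (G z). *)
Let Gf_small eta : 0 < eta -> exists d K, 0 < d /\ forall z, Cmod z < 1 ->
  Cmod (z - sigma)%C < d -> Cmod (Gf z) * (1 - Cmod z) <= K * (1 - Cmod z) + 16 * eta.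
Proof.
intros He; destruct (hc_approx eta He) as [z0 [Hz0 Hr]].
assert (P0 := Nz z0 Hz0); apply Cmod_gt_0 in P0; set (p := Cmod (sigma - z0)%C) in *.
(* For [z] within [p] of [sigma], [one_minus_bound] gives |1 - conj z0 z| <= 2 p. This [p ^ 2]
   cancels the one in the denominator of Re G(z0), so the final error [16 * eta] does not depend on
   how close [z0] is to the boundary. *)
exists p, (Cmod (Gf z0)); split; [exact P0|]; intros z Hz Hd.
assert (S := schwarz_pick_half_plane Gf z z0).
assert (S' : Cmod (Gf z + Cconj (Gf z0))%C ^ 2 * ((1 - Cmod z ^ 2) * (1 - Cmod z0 ^ 2))
  <= 4 * Re (Gf z) * Re (Gf z0) * Cmod (1 - Cconj z0 * z)%C ^ 2).
{ apply S; auto.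
  - intros u Hu; unfold Gf; apply cdiff_minus.
    + apply cdiff_div; [auto|apply cdiff_plus|apply cdiff_minus];
        try apply cdiff_const; apply self_map_cdiff; auto.
    + apply cdiff_mult; [apply cdiff_const|].
      apply cdiff_div; [auto|apply cdiff_plus|apply cdiff_minus];
        try apply cdiff_const; apply cdiff_id.
  - intros u Hu; rewrite Re_Gf by exact Hu; apply Rmult_le_pos.
    + generalize (hc_le u Hu); lra.
    + assert (B := Nz u Hu); apply Cmod_gt_0 in B.
      apply Rlt_le, Rdiv_lt_0_compat; [auto|apply pow_lt, B]. }
clear S; set (A := Cmod (Gf z + Cconj (Gf z0))%C) in *.
assert (HA : 0 <= A) by apply Cmod_ge_0.
assert (G0 : 0 <= Re (Gf z0) < eta * ((1 - Cmod z0 ^ 2) / p ^ 2)).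
{ rewrite Re_Gf by exact Hz0; fold p.
  assert (0 < (1 - Cmod z0 ^ 2) / p ^ 2) by (apply Rdiv_lt_0_compat; [auto|apply pow_lt, P0]).
  generalize (hc_le z0 Hz0); intros; split; [apply Rmult_le_pos; lra|].
  apply Rmult_lt_compat_r; lra. }
assert (HR : Re (Gf z) <= A).
{ apply Rle_trans with (Re (Gf z + Cconj (Gf z0))%C).
  - rewrite re_plus, re_conj; lra.
  - eapply Rle_trans; [apply Rle_abs|apply re_le_Cmod]. }
assert (HB : Cmod (1 - Cconj z0 * z)%C <= 2 * p).
{ eapply Rle_trans; [apply (one_minus_bound sigma hsigma); lra|].
  fold p; replace (sigma - z)%C with (- (z - sigma))%C by ring; rewrite Cmod_opp; lra. }
assert (HB2 : Cmod (1 - Cconj z0 * z)%C ^ 2 <= 4 * p ^ 2).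
{ generalize (Cmod_ge_0 (1 - Cconj z0 * z)%C); nra. }
assert (g0 := gap z0 Hz0); set (x0 := 1 - Cmod z0 ^ 2) in *.
assert (g := gap z Hz); set (x := 1 - Cmod z ^ 2) in *.
assert (Hp2 : 0 < p ^ 2) by (apply pow_lt, P0).
assert (Key : A * x <= 16 * eta).
{ destruct (Req_dec A 0) as [E|E]; [rewrite E; lra|].
  apply Rmult_le_reg_l with (A * x0); [apply Rmult_lt_0_compat; lra|].
  replace (A * x0 * (A * x)) with (A ^ 2 * (x * x0)) by ring.
  eapply Rle_trans; [exact S'|].
  apply Rle_trans with (4 * A * (eta * (x0 / p ^ 2)) * (4 * p ^ 2)).
  - apply Rle_trans with (4 * A * Re (Gf z0) * (4 * p ^ 2)).
    + apply Rle_trans with (4 * A * Re (Gf z0) * Cmod (1 - Cconj z0 * z)%C ^ 2).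
      * apply Rmult_le_compat_r; [apply pow2_ge_0|]; apply Rmult_le_compat_r; lra.
      * apply Rmult_le_compat_l; [|exact HB2]; apply Rmult_le_pos; lra.
    + apply Rmult_le_compat_r; [lra|]; apply Rmult_le_compat_l; lra.
  - right; field; lra. }
assert (T : Cmod (Gf z) <= A + Cmod (Gf z0)).
{ rewrite <- (Cmod_conj (Gf z0)), <- (Cmod_opp (Cconj _)).
  replace (Gf z) with (Gf z + Cconj (Gf z0) + - Cconj (Gf z0))%C at 1 by ring.
  apply Cmod_triangle. }
generalize (disc_gap z Hz); fold x; intros.
apply Rle_trans with ((A + Cmod (Gf z0)) * (1 - Cmod z)).
{ apply Rmult_le_compat_r; lra. }
assert (A * (1 - Cmod z) <= A * x) by (apply Rmult_le_compat_l; lra).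
lra.
Qed.

(** In a Stolz region |sigma - z| is below M (1 - |z|), so [Gf_small] applies after multiplication
    by M. The choice eta = eps / (32 M) makes the error eps / 2; the constant K depends on eta but
    multiplies 1 - |z|, which tends to 0. *)
Let Gf_lim M : 1 < M -> climit (stolz_filter sigma M) (fun z => (sigma - z) * Gf z)%C 0.
Proof.
intros HM eps He.
assert (He' : 0 < eps / (32 * M)) by (apply Rdiv_lt_0_compat; lra).
destruct (Gf_small _ He') as [d [K [Hd H]]].
set (K' := Rabs K + 1).
assert (HK' : 0 < K') by (unfold K'; generalize (Rabs_pos K); lra).
assert (He2 : 0 < eps / (2 * M * K')) by (apply Rdiv_lt_0_compat; [lra|apply Rmult_lt_0_compat; lra]).
apply stolz_filter_eps; exists (Rmin d (eps / (2 * M * K'))).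
split; [apply Rmin_glb_lt; auto|].
intros z [Hz Hs] Hdz.
replace ((sigma - z) * Gf z - 0)%C with (- ((z - sigma) * Gf z))%C by ring.
rewrite Cmod_opp, Cmod_mult.
generalize (Rmin_l d (eps / (2 * M * K'))) (Rmin_r d (eps / (2 * M * K'))); intros.
specialize (H z Hz ltac:(lra)).
assert (Hg : 1 - Cmod z <= Cmod (z - sigma)%C).
{ rewrite <- hsigma; generalize (Cmod_triangle z (- (z - sigma))%C).
  rewrite Cmod_opp; replace (z + - (z - sigma))%C with sigma by ring; lra. }
unfold in_disc in Hz.
assert (Hg0 := Cmod_ge_0 (Gf z)).
apply Rle_lt_trans with (M * (Cmod (Gf z) * (1 - Cmod z))).
{ rewrite (Rmult_comm (Cmod (Gf z))), <- Rmult_assoc; apply Rmult_le_compat_r; lra. }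
apply Rle_lt_trans with (M * (K * (1 - Cmod z) + 16 * (eps / (32 * M)))).
{ apply Rmult_le_compat_l; lra. }
replace (M * (K * (1 - Cmod z) + 16 * (eps / (32 * M))))
  with (M * (K * (1 - Cmod z)) + eps / 2) by (field; lra).
assert (M * (K * (1 - Cmod z)) < eps / 2); [|lra].
apply Rle_lt_trans with (M * (K' * (1 - Cmod z))).
{ apply Rmult_le_compat_l; [lra|]; apply Rmult_le_compat_r; [lra|].
  unfold K'; generalize (Rle_abs K); lra. }
apply Rlt_le_trans with (M * (K' * (eps / (2 * M * K')))).
{ apply Rmult_lt_compat_l; [lra|]; apply Rmult_lt_compat_l; lra. }
right; field; lra.
Qed.

(** Since f + 1 = 2 omega / (omega - phi), the reciprocal difference quotient (z - sigma) / (phi z -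
    omega) is an affine expression in (sigma - z) G(z) and z. It tends to c sigma / omega, which can
    be inverted because c is positive. *)
Lemma angular_derivative_of_inf : 0 < c ->
  is_angular_lim (fun z => ((phi z - omega) / (z - sigma))%C) sigma
    (RtoC (/ c) * (omega * Cconj sigma))%C.
Proof.
intros Hc; apply is_angular_lim_climit; intros M HM.
assert (FF : Filter (stolz_filter sigma M)) by (apply within_filter, locally_filter).
assert (Hc' : RtoC c <> RtoC 0) by (intros E; apply RtoC_inj in E; lra).
assert (Ho0 : omega <> RtoC 0) by (apply Cmod_gt_0; lra).
assert (Hs0 : sigma <> RtoC 0) by (apply Cmod_gt_0; lra).
assert (L : climit (stolz_filter sigma M)
  (fun z => ((sigma - z) * Gf z + RtoC c * (sigma + z) + (sigma - z)) / (RtoC 2 * omega))%C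
  ((0 + RtoC c * (sigma + sigma) + (sigma - sigma)) / (RtoC 2 * omega))%C).
{ assert (I := climit_stolz_id sigma M).
  apply climit_div; [apply Cmult_neq_0; auto; intros E; apply RtoC_inj in E; lra| |
    apply climit_const].
  apply climit_plus; [apply climit_plus; [apply Gf_lim, HM|]|].
  - apply climit_mult; [apply climit_const|apply climit_plus; [apply climit_const|exact I]].
  - apply climit_minus; [apply climit_const|exact I]. }
replace ((0 + RtoC c * (sigma + sigma) + (sigma - sigma)) / (RtoC 2 * omega))%C
  with (RtoC c * sigma / omega)%C in L by (field; auto).
apply climit_inv in L.
- replace (/ (c * sigma / omega))%C with (RtoC (/ c) * (omega * Cconj sigma))%C in L.
  + revert L; apply climit_ext_loc.
    apply stolz_filter_eps; exists 1; split; [lra|]; intros z [Hz _] _.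
    assert (A := Nphi z Hz); assert (B := Nz z Hz).
    assert (A' : (phi z - omega)%C <> RtoC 0).
    { intros E; apply A; replace (omega - phi z)%C with (- (phi z - omega))%C by ring.
      rewrite E; ring. }
    assert (B' : (z - sigma)%C <> RtoC 0).
    { intros E; apply B; replace (sigma - z)%C with (- (z - sigma))%C by ring.
      rewrite E; ring. }
    unfold Gf.
    replace (((sigma - z) * ((omega + phi z) / (omega - phi z)
        - c * ((sigma + z) / (sigma - z))) + c * (sigma + z) + (sigma - z)) / (2 * omega))%C
      with ((z - sigma) / (phi z - omega))%C by (field; auto).
    field; auto.
  + rewrite RtoC_inv by lra.
    assert (E : Cconj sigma = (/ sigma)%C).
    { replace (Cconj sigma) with (/ sigma * (sigma * Cconj sigma))%C by (field; auto).
      rewrite Cmod1_conj by exact hsigma; ring. }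
    rewrite E; field; auto.
- unfold Cdiv; repeat apply Cmult_neq_0; auto.
  intros E; apply (f_equal Cmod) in E; rewrite Cmod_inv, homega, Cmod_0 in E by exact Ho0; lra.
Qed.

End AngularDerivative.

(** Julia's inequality bounds [ratio] below by [/ (2 * K)], so its infimum c is positive and the
    derivative has modulus d = 1 / c. *)
Theorem julia_wolff_caratheodory (phi : C -> C) (sigma : C) :
  holomorphic_self_map phi -> Cmod sigma = 1 -> radially_bounded phi sigma ->
  exists (omega : C) (d : R), Cmod omega = 1 /\ 0 < d /\
    is_angular_lim (fun z => ((phi z - omega) / (z - sigma))%C) sigma
      (RtoC d * (omega * Cconj sigma))%C.
Proof.
intros hphi hsigma [K [r0 [Hr0 HK]]].
destruct (radial_boundary_value phi sigma hphi hsigma K r0 Hr0 HK) as [omega [Ho1 Ho]].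
assert (J := julia phi sigma hphi hsigma K r0 omega Hr0 Ho1 HK Ho).
assert (HK0 : 0 < K).
{ specialize (HK ((r0 + 1) / 2) ltac:(lra)).
  assert (Hl : Cmod (RtoC ((r0 + 1) / 2) * sigma)%C < 1)
    by (rewrite Cmod_radial by (auto; lra); lra).
  generalize (self_map_lt1 phi hphi _ Hl); intros; nra. }
assert (HKi : 0 < / (2 * K)) by (apply Rinv_0_lt_compat; lra).
set (ratio := fun z => (1 - Cmod (phi z) ^ 2) * Cmod (sigma - z)%C ^ 2
  / (Cmod (omega - phi z)%C ^ 2 * (1 - Cmod z ^ 2))).
destruct (glb_approx ratio (/ (2 * K))) as [c [Hc [Hc1 Hc2]]].
{ intros z Hz; specialize (J z Hz); unfold ratio.
  assert (A := Cmod_lt1_sub_neq0 _ _ Ho1 (self_map_lt1 phi hphi z Hz)).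
  apply Cmod_gt_0 in A; generalize (disc_gap z Hz); intros G.
  assert (HD : 0 < Cmod (omega - phi z)%C ^ 2 * (1 - Cmod z ^ 2)).
  { apply Rmult_lt_0_compat; [apply pow_lt, A|lra]. }
  apply Rle_div_r; [exact HD|].
  apply Rmult_le_reg_l with (2 * K); [lra|].
  rewrite <- Rmult_assoc, Rinv_r, Rmult_1_l by lra; lra. }
exists omega, (/ c); split; [exact Ho1|]; split; [apply Rinv_0_lt_compat; lra|].
apply angular_derivative_of_inf; auto; lra.
Qed.

(** * Hyperbolic distance, and the radial bound from each condition *)

Definition radial : (R -> Prop) -> Prop := within (fun r => 0 < r < 1) (locally 1).

Lemma radial_eps (P : R -> Prop) :
  radial P <-> exists r0, 0 <= r0 < 1 /\ forall r, r0 < r < 1 -> P r.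
Proof.
unfold radial, within; split.
- intros H; apply (locally_R 1) in H; destruct H as [d [Hd H]].
  exists (Rmax 0 (1 - d)); split.
  + split; [apply Rmax_l|apply Rmax_lub_lt; lra].
  + intros r Hr; generalize (Rmax_l 0 (1 - d)) (Rmax_r 0 (1 - d)); intros.
    apply H; [apply Rabs_def1|]; lra.
- intros [r0 [Hr0 H]]; apply (locally_R 1); exists (1 - r0); split; [lra|].
  intros r Hr Hr1; apply Rabs_def2 in Hr; apply H; lra.
Qed.

(* [sech2 z w = 1 / cosh^2 (k(z,w) / 2)], in terms of the hyperbolic distance. *)
Definition sech2 (z w : C) : R :=
  (1 - Cmod z ^ 2) * (1 - Cmod w ^ 2) / Cmod (1 - Cconj w * z)%C ^ 2.

Lemma conj_mul_gap_pos (z w : C) : Cmod z < 1 -> Cmod w < 1 ->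
  0 < Cmod (1 - Cconj w * z)%C.
Proof. intros Hz Hw; apply Cmod_gt_0, one_minus_conj_mul_neq0; lra. Qed.

Lemma sech2_pos z w : Cmod z < 1 -> Cmod w < 1 -> 0 < sech2 z w.
Proof.
intros Hz Hw; generalize (disc_gap z Hz) (disc_gap w Hw); intros.
apply Rdiv_lt_0_compat; [apply Rmult_lt_0_compat; lra|].
apply pow_lt, conj_mul_gap_pos; auto.
Qed.

Lemma pseudo_hyp_dist_sech2 z w : Cmod z < 1 -> Cmod w < 1 ->
  0 <= pseudo_hyp_dist z w < 1 /\ sech2 z w = 1 - pseudo_hyp_dist z w ^ 2.
Proof.
intros Hz Hw; unfold pseudo_hyp_dist.
assert (N := conj_mul_gap_pos z w Hz Hw).
assert (P := sech2_pos z w Hz Hw).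
rewrite Cmod_div by (apply Cmod_gt_0, N).
set (m := Cmod (1 - Cconj w * z)%C) in *; set (t := Cmod (z - w)%C).
assert (E : sech2 z w = 1 - (t / m) ^ 2).
{ unfold sech2; fold m.
  replace ((1 - Cmod z ^ 2) * (1 - Cmod w ^ 2)) with (m ^ 2 - t ^ 2).
  - field; lra.
  - unfold m, t; rewrite !Cmod2_alt; destruct z, w; simpl; ring. }
split; [|exact E].
assert (H0 : 0 <= t / m) by (apply Rdiv_le_0_compat; [apply Cmod_ge_0|exact N]).
split; [exact H0|]; rewrite E in P; nra.
Qed.

(** (1 + p) / (1 - p) = (1 + p)^2 / (1 - p^2). The first term stays between 0 and 2 ln 2, so the
    unbounded part of the distance is carried by [sech2] alone. *)
Lemma hyp_dist_sech2 z w : Cmod z < 1 -> Cmod w < 1 ->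
  hyp_dist z w = 2 * ln (1 + pseudo_hyp_dist z w) - ln (sech2 z w).
Proof.
intros Hz Hw; destruct (pseudo_hyp_dist_sech2 z w Hz Hw) as [H ->].
unfold hyp_dist; set (p := pseudo_hyp_dist z w) in *.
replace (1 - p ^ 2) with ((1 + p) * (1 - p)) by ring.
rewrite ln_mult, ln_div by lra; ring.
Qed.

Lemma ln_le_sub1 y : 0 < y -> ln y <= y - 1.
Proof.
intros Hy; generalize (exp_ineq1_le (ln y)); rewrite exp_ln by exact Hy; lra.
Qed.

Section Radial.
Variables (phi : C -> C) (sigma : C).
Hypothesis hphi : holomorphic_self_map phi.
Hypothesis hsigma : Cmod sigma = 1.

Let rad r : 0 < r < 1 -> Cmod (RtoC r * sigma)%C < 1.
Proof. intros; rewrite Cmod_radial by (auto; lra); lra. Qed.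

Let self z : Cmod z < 1 -> Cmod (phi z) < 1.
Proof. apply hphi. Qed.

Lemma radial_in_stolz M r : 1 < M -> 0 < r < 1 -> stolz sigma M (RtoC r * sigma)%C.
Proof.
intros HM Hr; split; [apply rad, Hr|].
rewrite Cmod_radial by (auto; lra).
replace (RtoC r * sigma - sigma)%C with (RtoC (r - 1) * sigma)%C
  by (rewrite RtoC_minus; ring).
rewrite Cmod_mult, Cmod_R, hsigma, Rabs_minus_sym, Rabs_pos_eq by lra; nra.
Qed.

Lemma Cmod_radial_sub r : r < 1 -> Cmod (RtoC r * sigma - sigma)%C = 1 - r.
Proof.
intros Hr; replace (RtoC r * sigma - sigma)%C with (RtoC (r - 1) * sigma)%C
  by (rewrite RtoC_minus; ring).
rewrite Cmod_mult, Cmod_R, hsigma, Rabs_minus_sym, Rabs_pos_eq by lra; ring.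
Qed.

Lemma climit_stolz_radial M f l : 1 < M -> climit (stolz_filter sigma M) f l ->
  climit radial (fun r => f (RtoC r * sigma)%C) l.
Proof.
intros HM H eps He; destruct (proj1 (stolz_filter_eps _ _ _) (H eps He)) as [d [Hd HP]].
apply radial_eps; exists (Rmax 0 (1 - d)); split.
- split; [apply Rmax_l|apply Rmax_lub_lt; lra].
- intros r Hr; generalize (Rmax_l 0 (1 - d)) (Rmax_r 0 (1 - d)); intros.
  apply HP; [apply radial_in_stolz; lra|].
  rewrite Cmod_radial_sub; lra.
Qed.

Lemma conformal_lipschitz omega l M :
  is_angular_lim (fun z => ((phi z - omega) / (z - sigma))%C) sigma l -> 1 < M ->
  exists d, 0 < d /\ forall z, stolz sigma M z -> Cmod (z - sigma)%C < d ->
    Cmod (phi z - omega)%C <= (Cmod l + 1) * Cmod (z - sigma)%C.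
Proof.
intros H HM; apply is_angular_lim_climit with (M := M) in H; [|exact HM].
assert (FF : Filter (stolz_filter sigma M)) by (apply within_filter, locally_filter).
apply climit_bounded in H; destruct (proj1 (stolz_filter_eps _ _ _) H) as [d [Hd HP]].
exists d; split; [exact Hd|]; intros z Hz Hd'.
assert (N : (z - sigma)%C <> RtoC 0).
{ intros E; apply (Cmod_lt1_sub_neq0 sigma z hsigma (proj1 Hz)).
  replace (sigma - z)%C with (- (z - sigma))%C by ring; rewrite E; ring. }
specialize (HP z Hz Hd'); rewrite Cmod_div in HP by exact N.
apply Cmod_gt_0 in N; apply Rlt_div_l in HP; lra.
Qed.

Lemma conformal_radially_bounded : conformal_strong phi sigma -> radially_bounded phi sigma.
Proof.
intros [omega [Ho [l Hl]]].
(* Any opening above 1 would do, since the radius lies in every Stolz region. *)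
destruct (conformal_lipschitz omega l 2 Hl ltac:(lra)) as [d [Hd H]].
exists (Cmod l + 1), (Rmax 0 (1 - d)); split.
- split; [apply Rmax_l|apply Rmax_lub_lt; lra].
- intros r Hr; generalize (Rmax_l 0 (1 - d)) (Rmax_r 0 (1 - d)); intros.
  specialize (H (RtoC r * sigma)%C ltac:(apply radial_in_stolz; lra)).
  rewrite Cmod_radial_sub in H by lra; specialize (H ltac:(lra)).
  generalize (Cmod_triangle (phi (RtoC r * sigma)) (- (phi (RtoC r * sigma) - omega))%C).
  replace (phi (RtoC r * sigma) + - (phi (RtoC r * sigma) - omega))%C with omega by ring.
  rewrite Cmod_opp; lra.
Qed.

Lemma radially_bounded_conformal : radially_bounded phi sigma -> conformal_strong phi sigma.
Proof.
intros H; destruct (julia_wolff_caratheodory phi sigma hphi hsigma H)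
  as [omega [d [Ho [Hd HL]]]].
exists omega; split; [exact Ho|]; eexists; exact HL.
Qed.

Lemma sech2_radially_bounded (s E r0 : R) : 0 < s < 1 -> 0 <= r0 < 1 ->
  (forall r, r0 < r < 1 ->
    sech2 (phi (RtoC r * sigma)) (phi (RtoC s * sigma))
      <= E * sech2 (RtoC r * sigma)%C (RtoC s * sigma)%C) ->
  radially_bounded phi sigma.
Proof.
intros Hs Hr0 H.
assert (Gs := disc_gap _ (self _ (rad s Hs))).
assert (Ls := self _ (rad s Hs)).
set (b := 1 - Cmod (phi (RtoC s * sigma)) ^ 2) in *.
(* The 8 is 4, from the squared bound 2 on the denominator at the images, times 2, from 1 - r^2 <= 2
   (1 - r). The factor (1 - s)^2 bounds (1 - r s)^2 from below. *)
exists (8 * Rabs E * (1 - s ^ 2) / ((1 - s) ^ 2 * b)), r0; split; [exact Hr0|].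
intros r Hr; specialize (H r Hr).
assert (Hr1 : 0 < r < 1) by lra.
assert (Gr := disc_gap _ (self _ (rad r Hr1))).
assert (Lr := self _ (rad r Hr1)).
unfold sech2 in H; fold b in H.
rewrite one_minus_radial, Cmod_R, pow2_abs, !Cmod_radial in H by (auto; lra).
set (a := 1 - Cmod (phi (RtoC r * sigma)) ^ 2) in *.
assert (N := conj_mul_gap_pos _ _ Lr Ls).
assert (M : Cmod (1 - Cconj (phi (RtoC s * sigma)) * phi (RtoC r * sigma))%C ^ 2 <= 4).
{ assert (Cmod (1 - Cconj (phi (RtoC s * sigma)) * phi (RtoC r * sigma))%C <= 2).
  - eapply Rle_trans; [apply Cmod_triangle|].
    rewrite Cmod_opp, Cmod_mult, Cmod_conj, Cmod_1.
    generalize (Cmod_ge_0 (phi (RtoC s * sigma))) (Cmod_ge_0 (phi (RtoC r * sigma))); nra.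
  - nra. }
set (m := Cmod (1 - Cconj (phi (RtoC s * sigma)) * phi (RtoC r * sigma))%C) in *.
assert (Hab : a * b <= 4 * (a * b / m ^ 2)).
{ replace (4 * (a * b / m ^ 2)) with (a * b * (4 / m ^ 2)) by (field; lra).
  replace (a * b) with (a * b * 1) at 1 by ring.
  apply Rmult_le_compat_l; [apply Rmult_le_pos; lra|].
  apply Rle_div_r; [apply pow_lt, N|lra]. }
assert (Q : 0 <= (1 - r ^ 2) * (1 - s ^ 2) / (1 - r * s) ^ 2
  <= 2 * (1 - r) * (1 - s ^ 2) / (1 - s) ^ 2).
{ assert (0 < (1 - r * s) ^ 2) by (apply pow_lt; nra).
  assert (0 < (1 - s) ^ 2) by (apply pow_lt; lra).
  assert (0 <= (1 - r ^ 2) * (1 - s ^ 2)) by (apply Rmult_le_pos; nra).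
  split; [apply Rdiv_le_0_compat; auto|].
  apply Rle_trans with ((1 - r ^ 2) * (1 - s ^ 2) / (1 - s) ^ 2).
  - apply Rmult_le_compat_l; [auto|]; apply Rinv_le_contravar; [auto|].
    apply pow_incr; nra.
  - apply Rmult_le_compat_r; [apply Rlt_le, Rinv_0_lt_compat; auto|].
    apply Rmult_le_compat_r; nra. }
assert (HE : E * ((1 - r ^ 2) * (1 - s ^ 2) / (1 - r * s) ^ 2)
  <= Rabs E * (2 * (1 - r) * (1 - s ^ 2) / (1 - s) ^ 2)).
{ apply Rle_trans with (Rabs E * ((1 - r ^ 2) * (1 - s ^ 2) / (1 - r * s) ^ 2)).
  - apply Rmult_le_compat_r; [lra|apply Rle_abs].
  - apply Rmult_le_compat_l; [apply Rabs_pos|lra]. }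
apply Rle_trans with a; [lra|].
apply Rmult_le_reg_r with b; [lra|].
replace (8 * Rabs E * (1 - s ^ 2) / ((1 - s) ^ 2 * b) * (1 - r) * b)
  with (4 * (Rabs E * (2 * (1 - r) * (1 - s ^ 2) / (1 - s) ^ 2)))
  by (field; lra).
lra.
Qed.

Lemma hyp_dist_radially_bounded :
  filterlim
    (fun p : R * R =>
       hyp_dist (RtoC (fst p) * sigma)%C (RtoC (snd p) * sigma)%C
       - hyp_dist (phi (RtoC (fst p) * sigma)%C) (phi (RtoC (snd p) * sigma)%C))
    (filter_prod radial radial) (locally 0) ->
  radially_bounded phi sigma.
Proof.
intros H.
assert (L : locally 0 (fun x : R => Rabs x < 1)).
{ apply (locally_R 0); exists 1; split; [lra|]; intros y; rewrite Rminus_0_r; auto. }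
specialize (H _ L); destruct H as [Q1 Q2 H1 H2 H].
apply radial_eps in H1; destruct H1 as [r1 [Hr1 H1]].
apply radial_eps in H2; destruct H2 as [r2 [Hr2 H2]].
set (s := (r2 + 1) / 2); assert (Hs : r2 < s < 1) by (unfold s; lra).
(* The 1 is the chosen bound on the difference of distances, and 2 ln 2 bounds the term
   [2 * ln (1 + p')] of [hyp_dist_sech2] at the images. *)
apply (sech2_radially_bounded s (exp (1 + 2 * ln 2)) r1); [lra|lra|].
intros r Hr; specialize (H r s (H1 r Hr) (H2 s Hs)); simpl in H.
assert (Zr := rad r ltac:(lra)); assert (Zs := rad s ltac:(lra)).
rewrite !hyp_dist_sech2 in H by auto.
destruct (pseudo_hyp_dist_sech2 _ _ Zr Zs) as [P _].
destruct (pseudo_hyp_dist_sech2 _ _ (self _ Zr) (self _ Zs)) as [P' _].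
assert (S := sech2_pos _ _ Zr Zs); assert (S' := sech2_pos _ _ (self _ Zr) (self _ Zs)).
set (p := pseudo_hyp_dist (RtoC r * sigma)%C _) in *.
set (p' := pseudo_hyp_dist _ _) in P', H.
assert (0 <= ln (1 + p)) by (rewrite <- ln_1; apply ln_le; lra).
assert (ln (1 + p') <= ln 2) by (apply ln_le; lra).
apply Rabs_def2 in H.
rewrite <- (exp_ln _ S), <- exp_plus, <- (exp_ln _ S').
apply Rnot_lt_le; intros L'; apply exp_lt_inv in L'; lra.
Qed.

End Radial.

(** * From the radial bound to asymptotic preservation of hyperbolic distance *)

Lemma climit_Cmod {T} (F : (T -> Prop) -> Prop) {FF : Filter F} f (l : C) :
  climit F f l -> climit F (fun t => RtoC (Cmod (f t))) (RtoC (Cmod l)).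
Proof.
intros H eps He; generalize (H eps He); apply filter_imp; intros t Ht.
rewrite <- RtoC_minus, Cmod_R.
eapply Rle_lt_trans; [apply Rabs_Cmod_sub|exact Ht].
Qed.

Lemma Rabs_ln_le L : Rabs (L - 1) <= / 2 -> Rabs (ln L) <= 2 * Rabs (L - 1).
Proof.
intros H; apply Rabs_le_between in H.
assert (A := ln_le_sub1 L ltac:(lra)).
assert (B := ln_le_sub1 (/ L) ltac:(apply Rinv_0_lt_compat; lra)).
rewrite ln_Rinv in B by lra.
assert (D : Rabs (/ L - 1) <= 2 * Rabs (L - 1)).
{ replace (/ L - 1) with (/ L * (1 - L)) by (field; lra).
  rewrite Rabs_mult, (Rabs_minus_sym 1 L).
  apply Rmult_le_compat_r; [apply Rabs_pos|].
  rewrite Rabs_pos_eq by (apply Rlt_le, Rinv_0_lt_compat; lra).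
  replace 2 with (/ / 2) by (field; lra); apply Rinv_le_contravar; lra. }
generalize (Rle_abs (L - 1)) (Rle_abs (/ L - 1)) (Rabs_pos (L - 1)); intros.
apply Rabs_le; lra.
Qed.

Lemma Rabs_ln_sub_le x y : 0 <= x -> 0 <= y ->
  Rabs (ln (1 + x) - ln (1 + y)) <= Rabs (x - y).
Proof.
assert (K : forall x y, 0 <= x -> 0 <= y -> ln (1 + x) - ln (1 + y) <= Rabs (x - y)).
{ intros u v Hu Hv; rewrite <- ln_div by lra.
  assert (H : 0 < (1 + u) / (1 + v)) by (apply Rdiv_lt_0_compat; lra).
  eapply Rle_trans; [apply ln_le_sub1, H|].
  replace ((1 + u) / (1 + v) - 1) with (/ (1 + v) * (u - v)) by (field; lra).
  apply Rle_trans with (/ (1 + v) * Rabs (u - v)).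
  - apply Rmult_le_compat_l; [apply Rlt_le, Rinv_0_lt_compat; lra|apply Rle_abs].
  - rewrite <- (Rmult_1_l (Rabs (u - v))) at 2; apply Rmult_le_compat_r; [apply Rabs_pos|].
    rewrite <- Rinv_1; apply Rinv_le_contravar; lra. }
intros Hx Hy; generalize (K x y Hx Hy) (K y x Hy Hx); rewrite (Rabs_minus_sym y x).
intros; apply Rabs_le; lra.
Qed.

(** With L the quotient of the two [sech2], the difference is ln L plus twice ln (1 + p) - ln (1 +
    p'). For the second part L only controls p^2 - p'^2, and |p - p'|^2 <= |p^2 - p'^2| costs a
    square root; hence the [e ^ 2] in the hypothesis. *)
Lemma hyp_dist_sub_le (z w z' w' : C) (e : R) :
  Cmod z < 1 -> Cmod w < 1 -> Cmod z' < 1 -> Cmod w' < 1 -> 0 < e <= / 2 ->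
  Rabs (sech2 z' w' / sech2 z w - 1) < e ^ 2 ->
  Rabs (hyp_dist z w - hyp_dist z' w') <= 4 * e.
Proof.
intros Hz Hw Hz' Hw' He H.
rewrite !hyp_dist_sech2 by assumption.
destruct (pseudo_hyp_dist_sech2 z w Hz Hw) as [P E].
destruct (pseudo_hyp_dist_sech2 z' w' Hz' Hw') as [P' E'].
assert (S := sech2_pos z w Hz Hw); assert (S' := sech2_pos z' w' Hz' Hw').
set (p := pseudo_hyp_dist z w) in *; set (p' := pseudo_hyp_dist z' w') in *.
set (q := sech2 z w) in *; set (q' := sech2 z' w') in *.
set (L := q' / q) in *.
assert (He2 : e ^ 2 <= / 2 * e) by nra.
assert (HL : Rabs (ln L) <= 2 * Rabs (L - 1)) by (apply Rabs_ln_le; lra).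
assert (Hp : Rabs (p - p') <= e).
{ assert (Hq : q * Rabs (L - 1) = Rabs (p ^ 2 - p' ^ 2)).
  { replace (p ^ 2 - p' ^ 2) with (q * (L - 1)) by (unfold L; field_simplify; lra).
    rewrite Rabs_mult, (Rabs_pos_eq q); lra. }
  assert (Hs : Rabs (p - p') ^ 2 <= Rabs (p ^ 2 - p' ^ 2)).
  { replace (p ^ 2 - p' ^ 2) with ((p - p') * (p + p')) by ring.
    rewrite Rabs_mult, (Rabs_pos_eq (p + p')) by lra.
    simpl; rewrite Rmult_1_r; apply Rmult_le_compat_l; [apply Rabs_pos|].
    apply Rabs_le; lra. }
  assert (q <= 1) by nra.
  assert (q * Rabs (L - 1) <= Rabs (L - 1)) by (generalize (Rabs_pos (L - 1)); nra).
  generalize (Rabs_pos (p - p')); intros; nra. }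
assert (HD := Rabs_ln_sub_le p p' ltac:(lra) ltac:(lra)).
replace (2 * ln (1 + p) - ln q - (2 * ln (1 + p') - ln q'))
  with (ln L + 2 * (ln (1 + p) - ln (1 + p'))) by (unfold L; rewrite ln_div by lra; ring).
eapply Rle_trans; [apply Rabs_triang|].
rewrite Rabs_mult, (Rabs_pos_eq 2) by lra; lra.
Qed.

Section RadialToHyperbolic.
Variables (phi : C -> C) (sigma : C).
Hypothesis hphi : holomorphic_self_map phi.
Hypothesis hsigma : Cmod sigma = 1.

Let rad r : 0 < r < 1 -> Cmod (RtoC r * sigma)%C < 1.
Proof. intros; rewrite Cmod_radial by (auto; lra); lra. Qed.

Let self z : Cmod z < 1 -> Cmod (phi z) < 1.
Proof. apply hphi. Qed.

(* The quotient of [sech2] at the images by [sech2] at the points is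
   |tau r r| |tau s s| / |tau r s|^2, and tau tends to the angular derivative. *)
Let tau (r s : R) : C :=
  ((1 - Cconj (phi (RtoC s * sigma)) * phi (RtoC r * sigma)) / RtoC (1 - r * s))%C.

(** Writing phi (t sigma) = omega (1 - (1 - t) alpha t) and x = 1 - r, y = 1 - s, the numerator of
    [tau] is x alpha r + y conj (alpha s) - x y conj (alpha s) alpha r, while 1 - r s = x + y - x y.
    The limit is joint in r and s because x and y are each at most 1 - r s. *)
Let tau_lim omega d : Cmod omega = 1 -> 0 < d ->
  is_angular_lim (fun z => ((phi z - omega) / (z - sigma))%C) sigma
      (RtoC d * (omega * Cconj sigma))%C ->
  forall eps, 0 < eps -> exists r0, 0 <= r0 < 1 /\ forall r s,
    r0 < r < 1 -> r0 < s < 1 -> Cmod (tau r s - RtoC d)%C < eps.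
Proof.
intros Ho Hd HL eps He.
(* The difference quotient, rotated so that its limit is the positive number [d]. *)
set (alpha := fun r => (((phi (RtoC r * sigma) - omega) / (RtoC r * sigma - sigma))
  * (sigma * Cconj omega))%C).
assert (La : climit radial alpha (RtoC d)).
{ replace (RtoC d) with (RtoC d * (omega * Cconj sigma) * (sigma * Cconj omega))%C.
  - assert (FF : Filter radial) by (apply within_filter, locally_filter).
    apply climit_mult; [|apply climit_const].
    apply (climit_stolz_radial sigma hsigma 2
      (fun z => (phi z - omega) / (z - sigma))%C); [lra|].
    apply is_angular_lim_climit; [exact HL|lra].
  - replace (RtoC d * (omega * Cconj sigma) * (sigma * Cconj omega))%C
      with (RtoC d * ((omega * Cconj omega) * (sigma * Cconj sigma)))%C by ring.
    rewrite !Cmod1_conj by assumption; ring. }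
(* Bounds the coefficient of the second-order term x y, given |alpha| <= d + 1; the minimum with 1
   below secures that bound, and y <= eps / (4 B) then makes the term at most a quarter of the
   allowance. *)
set (B := (d + 1) * (d + 1) + d).
assert (HB : 0 < B) by (unfold B; nra).
assert (He' : 0 < Rmin (eps / 4) 1) by (apply Rmin_glb_lt; lra).
destruct (proj1 (radial_eps _) (La _ He')) as [r1 [Hr1 Ha]].
assert (He2 : 0 < eps / (4 * B)) by (apply Rdiv_lt_0_compat; lra).
exists (Rmax r1 (1 - eps / (4 * B))); split.
{ split; [apply Rle_trans with r1; [lra|apply Rmax_l]|apply Rmax_lub_lt; lra]. }
intros r s Hr Hs.
generalize (Rmax_l r1 (1 - eps / (4 * B))) (Rmax_r r1 (1 - eps / (4 * B))); intros M1 M2.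
generalize (Rmin_l (eps / 4) 1) (Rmin_r (eps / 4) 1); intros M3 M4.
assert (Hr' : r1 < r < 1) by lra; assert (Hs' : r1 < s < 1) by lra.
assert (Ar := Ha r Hr'); assert (As := Ha s Hs').
assert (Ephi : forall t, r1 < t < 1 ->
  phi (RtoC t * sigma)%C = (omega * (1 - RtoC (1 - t) * alpha t))%C).
{ intros t Ht; unfold alpha.
  assert (N : (RtoC t * sigma - sigma)%C <> RtoC 0)
    by (apply Cmod_gt_0; rewrite Cmod_radial_sub by (auto; lra); lra).
  replace (omega * (1 - RtoC (1 - t) *
     ((phi (t * sigma) - omega) / (t * sigma - sigma) * (sigma * Cconj omega))))%C
    with (omega + (omega * Cconj omega) * (t * sigma - sigma) *
      ((phi (t * sigma) - omega) / (t * sigma - sigma)))%C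
    by (rewrite RtoC_minus; ring).
  rewrite Cmod1_conj by exact Ho; field; exact N. }
assert (Bd : forall t, Cmod (alpha t - RtoC d)%C < Rmin (eps / 4) 1 ->
  Cmod (alpha t) <= d + 1).
{ intros t Ht; replace (alpha t) with (RtoC d + (alpha t - RtoC d))%C by ring.
  eapply Rle_trans; [apply Cmod_triangle|]; rewrite Cmod_R, Rabs_pos_eq by lra; lra. }
set (x := 1 - r); set (y := 1 - s).
assert (Hx : 0 < x) by (unfold x; lra); assert (Hy : 0 < y) by (unfold y; lra).
assert (Hxy : x <= 1 - r * s /\ y <= 1 - r * s) by (unfold x, y; split; nra).
assert (N0 : RtoC (1 - r * s) <> RtoC 0) by (intros E; apply RtoC_inj in E; lra).
assert (E : (tau r s - RtoC d)%C =
  ((RtoC x * (alpha r - RtoC d) + RtoC y * Cconj (alpha s - RtoC d)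
    - RtoC (x * y) * (Cconj (alpha s) * alpha r - RtoC d)) / RtoC (1 - r * s))%C).
{ unfold tau; rewrite (Ephi r Hr'), (Ephi s Hs'); fold x y.
  rewrite Cmult_conj, !Cminus_conj, Cmult_conj, !Cconj_RtoC.
  replace (Cconj omega * (1 - RtoC y * Cconj (alpha s)) * (omega * (1 - RtoC x * alpha r)))%C
    with ((omega * Cconj omega) * ((1 - RtoC y * Cconj (alpha s)) * (1 - RtoC x * alpha r)))%C
    by ring.
  rewrite Cmod1_conj by exact Ho.
  replace (RtoC (1 - r * s)) with (RtoC x + RtoC y - RtoC x * RtoC y)%C in *
    by (rewrite <- RtoC_mult, <- RtoC_plus, <- RtoC_minus; f_equal; unfold x, y; ring).
  rewrite RtoC_mult; field; exact N0. }
rewrite E, Cmod_div, Cmod_R, (Rabs_pos_eq (1 - r * s)) by (auto; lra).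
apply Rlt_div_l; [lra|].
eapply Rle_lt_trans; [apply Cmod_triangle|].
rewrite Cmod_opp.
assert (T1 : Cmod (RtoC x * (alpha r - RtoC d) + RtoC y * Cconj (alpha s - RtoC d))%C
  <= (1 - r * s) * (eps / 4) + (1 - r * s) * (eps / 4)).
{ eapply Rle_trans; [apply Cmod_triangle|].
  rewrite !Cmod_mult, Cmod_conj, !Cmod_R, !Rabs_pos_eq by lra.
  apply Rplus_le_compat; apply Rmult_le_compat; try apply Cmod_ge_0; lra. }
assert (T2 : Cmod (Cconj (alpha s) * alpha r - RtoC d)%C <= B).
{ eapply Rle_trans; [apply Cmod_triangle|].
  rewrite Cmod_opp, Cmod_mult, Cmod_conj, Cmod_R, Rabs_pos_eq by lra.
  unfold B; apply Rplus_le_compat_r.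
  apply Rmult_le_compat; try apply Cmod_ge_0; apply Bd; assumption. }
assert (T3 : Cmod (RtoC (x * y) * (Cconj (alpha s) * alpha r - RtoC d))%C
  <= (1 - r * s) * (eps / 4)).
{ assert (Hyb : y * B <= eps / 4).
  { replace (eps / 4) with (eps / (4 * B) * B) by (field; lra).
    apply Rmult_le_compat_r; unfold y; lra. }
  rewrite Cmod_mult, Cmod_R, Rabs_pos_eq by (apply Rmult_le_pos; lra).
  rewrite Rmult_assoc; apply Rmult_le_compat; [lra| |lra|].
  - apply Rmult_le_pos; [lra|apply Cmod_ge_0].
  - apply Rle_trans with (y * B); [apply Rmult_le_compat_l; lra|exact Hyb]. }
assert (0 < (1 - r * s) * eps) by (apply Rmult_lt_0_compat; lra).
lra.
Qed.

(** Every factor |tau| in the quotient of the two [sech2] tends to the same nonzero [d], so the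
    quotient tends to 1 and [hyp_dist_sub_le] applies. *)
Lemma radially_bounded_hyp_dist : radially_bounded phi sigma ->
  filterlim
    (fun p : R * R =>
       hyp_dist (RtoC (fst p) * sigma)%C (RtoC (snd p) * sigma)%C
       - hyp_dist (phi (RtoC (fst p) * sigma)%C) (phi (RtoC (snd p) * sigma)%C))
    (filter_prod radial radial) (locally 0).
Proof.
intros HRB; destruct (julia_wolff_caratheodory phi sigma hphi hsigma HRB)
  as [omega [d [Ho [Hd HL]]]].
assert (HT := tau_lim omega d Ho Hd HL).
assert (FR : Filter radial) by (apply within_filter, locally_filter).
set (Fp := filter_prod radial radial).
assert (FP : Filter Fp) by (apply filter_prod_filter; assumption).
(* Here [f] and [g] pick coordinates of the pair, so one statement covers [tau] at (r, r), (s, s)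
   and (r, s). *)
assert (Tlim : forall f g : R * R -> R,
  (forall p, {f p = fst p} + {f p = snd p}) -> (forall p, {g p = fst p} + {g p = snd p}) ->
  climit Fp (fun p => RtoC (Cmod (tau (f p) (g p)))) (RtoC d)).
{ intros f g Hf Hg.
  replace (RtoC d) with (RtoC (Cmod (RtoC d))) by (rewrite Cmod_R, Rabs_pos_eq; auto; lra).
  apply climit_Cmod; [exact FP|]; intros eps He; destruct (HT eps He) as [r0 [Hr0 H]].
  assert (HQ : radial (fun r => r0 < r < 1)) by (apply radial_eps; exists r0; auto).
  apply Filter_prod with (1 := HQ) (2 := HQ); intros r s Hr Hs.
  apply H; [destruct (Hf (r, s)) as [-> | ->]|destruct (Hg (r, s)) as [-> | ->]]; auto. }
assert (d0 : RtoC d <> RtoC 0) by (intros E; apply RtoC_inj in E; lra).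
assert (LL : climit Fp (fun p => RtoC (Cmod (tau (fst p) (fst p)))
  * RtoC (Cmod (tau (snd p) (snd p)))
  / (RtoC (Cmod (tau (fst p) (snd p))) * RtoC (Cmod (tau (fst p) (snd p)))))%C (RtoC 1)).
{ replace (RtoC 1) with (RtoC d * RtoC d / (RtoC d * RtoC d))%C by (field; auto).
  apply climit_div; [apply Cmult_neq_0; auto| |];
    apply climit_mult; apply Tlim; intros; auto. }
intros P HP; apply (locally_R 0) in HP; destruct HP as [eps [He HP]].
set (e := Rmin (eps / 8) (/ 2)).
assert (He1 : 0 < e) by (apply Rmin_glb_lt; lra).
generalize (Rmin_l (eps / 8) (/ 2)) (Rmin_r (eps / 8) (/ 2)); fold e; intros e1 e2.
assert (HQ : radial (fun r => 0 < r < 1)).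
{ apply radial_eps; exists 0; split; [lra|auto]. }
assert (HQQ : Fp (fun p => 0 < fst p < 1 /\ 0 < snd p < 1)).
{ apply Filter_prod with (1 := HQ) (2 := HQ); intros; simpl; auto. }
generalize (filter_and _ _ HQQ (LL (e ^ 2) ltac:(apply pow_lt; lra))).
unfold filtermap; apply filter_imp; intros [r s] [[Hr Hs] H]; simpl in Hr, Hs.
simpl fst in *; simpl snd in *; apply HP; rewrite Rminus_0_r.
apply Rle_lt_trans with (4 * e); [|lra].
assert (Zr := rad r Hr); assert (Zs := rad s Hs).
apply hyp_dist_sub_le; auto.
assert (TM : forall u v, 0 < u < 1 -> 0 < v < 1 -> Cmod (tau u v) =
  Cmod (1 - Cconj (phi (RtoC v * sigma)) * phi (RtoC u * sigma))%C / (1 - u * v)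
  /\ 0 < 1 - u * v).
{ intros u v Hu Hv; assert (0 < 1 - u * v) by nra; split; [|auto].
  unfold tau; rewrite Cmod_div, Cmod_R, Rabs_pos_eq by
    (try lra; intros E; apply RtoC_inj in E; lra); reflexivity. }
assert (TD : forall u, 0 < u < 1 ->
  Cmod (1 - Cconj (phi (RtoC u * sigma)) * phi (RtoC u * sigma))%C
  = 1 - Cmod (phi (RtoC u * sigma)) ^ 2).
{ intros u Hu; rewrite Cmult_comm, <- Cmod2_conj, <- RtoC_minus, Cmod_R, Rabs_pos_eq;
    [reflexivity|]; generalize (disc_gap _ (self _ (rad u Hu))); lra. }
assert (Nrs := conj_mul_gap_pos _ _ (self _ Zr) (self _ Zs)).
destruct (TM r r Hr Hr) as [Trr Prr]; destruct (TM s s Hs Hs) as [Tss Pss];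
  destruct (TM r s Hr Hs) as [Trs Prs].
rewrite TD in Trr by exact Hr; rewrite TD in Tss by exact Hs.
assert (P0 : 0 < Cmod (tau r s)) by (rewrite Trs; apply Rdiv_lt_0_compat; auto).
rewrite <- !RtoC_mult, <- RtoC_div, <- RtoC_minus, Cmod_R in H
  by (apply Rgt_not_eq, Rmult_lt_0_compat; auto).
replace (sech2 (phi (RtoC r * sigma)) (phi (RtoC s * sigma))
   / sech2 (RtoC r * sigma)%C (RtoC s * sigma)%C)
  with (Cmod (tau r r) * Cmod (tau s s) / (Cmod (tau r s) * Cmod (tau r s))); [exact H|].
rewrite Trr, Tss, Trs; unfold sech2.
rewrite one_minus_radial, Cmod_R, pow2_abs, !Cmod_radial by (auto; lra).
field; repeat split; lra.
Qed.

End RadialToHyperbolic.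

(** * Normalised kernel functions of the de Branges-Rovnyak space *)

Lemma filter_liminf_gt0 {T} (F : (T -> Prop) -> Prop) (f : T -> R) :
  Rbar_lt 0 (filter_liminf F f) <->
  exists V y, F V /\ 0 < y /\ forall x, V x -> y <= f x.
Proof.
unfold filter_liminf.
set (E := fun y : Rbar => exists V : T -> Prop,
  F V /\ y = Glb_Rbar (fun t : R => exists x, V x /\ t = f x)).
destruct (proj2_sig (Rbar_ex_lub E)) as [HU HL]; fold (Rbar_lub E) in HU, HL; split.
- intros H; destruct (classic (exists y, E y /\ Rbar_lt 0 y)) as [[y [[V [HV Ey]] Hy]]|N].
  + destruct (Glb_Rbar_correct (fun t : R => exists x, V x /\ t = f x)) as [HG _].
    rewrite <- Ey in HG.
    assert (HG' : forall x, V x -> Rbar_le y (f x)) by (intros x Hx; apply HG; exists x; auto).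
    destruct y as [y| |].
    * exists V, y; split; [exact HV|]; split; [exact Hy|exact HG'].
    (* An infimum of plus infinity means that [V] is empty, so any positive number is a lower
       bound. *)
    * exists V, 1; split; [exact HV|]; split; [lra|]; intros x Hx; destruct (HG' x Hx).
    * destruct Hy.
  + exfalso; apply (Rbar_lt_not_le _ _ H); apply HL.
    intros y Hy; apply Rbar_not_lt_le; intros L; apply N; exists y; auto.
- intros [V [y [HV [Hy H]]]].
  apply Rbar_lt_le_trans with (Glb_Rbar (fun t : R => exists x, V x /\ t = f x)).
  + apply Rbar_lt_le_trans with y; [exact Hy|].
    apply Glb_Rbar_correct; intros t [x [Hx ->]]; apply H, Hx.
  + apply HU; exists V; auto.
Qed.

Section Kernel.
Variables (phi : C -> C) (sigma : C).
Hypothesis hphi : holomorphic_self_map phi.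
Hypothesis hsigma : Cmod sigma = 1.
Variable H : hilbert_function_space unit_disc.
Hypothesis hH : is_dBR_space phi H.

Let self z : Cmod z < 1 -> Cmod (phi z) < 1.
Proof. apply hphi. Qed.

Let coherence (z w : C) : R :=
  Cmod (inner H (dBR_kernel phi z) (dBR_kernel phi w))
  / (hnorm H (dBR_kernel phi z) * hnorm H (dBR_kernel phi w)).

Let inner_kernel (z w : C) : Cmod z < 1 -> Cmod w < 1 ->
  inner H (dBR_kernel phi z) (dBR_kernel phi w)
  = ((1 - Cconj (phi z) * phi w) / (1 - Cconj z * w))%C.
Proof.
intros Hz Hw; destruct (hH (mk_unit_disc w Hw)) as [_ Hr].
exact (eq_sym (Hr _ (proj1 (hH (mk_unit_disc z Hz))))).
Qed.

Let hnorm_kernel (z : C) : Cmod z < 1 ->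
  hnorm H (dBR_kernel phi z) = sqrt ((1 - Cmod (phi z) ^ 2) / (1 - Cmod z ^ 2)).
Proof.
intros Hz; unfold hnorm; f_equal; rewrite inner_kernel by assumption.
rewrite (Cmult_comm (Cconj z)), (Cmult_comm (Cconj (phi z))), <- !Cmod2_conj.
rewrite <- !RtoC_minus, <- RtoC_div; [reflexivity|].
generalize (disc_gap z Hz); lra.
Qed.

(** The reproducing property evaluates the inner product and both norms; squaring removes the square
    roots. This carries the lower bound in (c') over to the quotient that governs (b'), inverted. *)
Lemma coherence_sech2 (z w : C) : Cmod z < 1 -> Cmod w < 1 ->
  0 <= coherence z w /\ coherence z w ^ 2 = sech2 z w / sech2 (phi z) (phi w).
Proof.
intros Hz Hw; unfold coherence.
rewrite inner_kernel, !hnorm_kernel by assumption.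
assert (N1 := conj_mul_gap_pos z w Hz Hw).
assert (N2 := conj_mul_gap_pos _ _ (self z Hz) (self w Hw)).
assert (Sym : forall a b : C, Cmod (1 - Cconj a * b)%C = Cmod (1 - Cconj b * a)%C).
{ intros a b; rewrite <- (Cmod_conj (1 - Cconj a * b)%C), Cminus_conj, Cmult_conj, Cconj_conj.
  rewrite Cconj_RtoC.
  do 2 f_equal; ring. }
rewrite Cmod_div by (apply Cmod_gt_0; rewrite Sym; exact N1).
rewrite (Sym (phi z)), (Sym z).
generalize (disc_gap z Hz) (disc_gap w Hw) (disc_gap _ (self z Hz)) (disc_gap _ (self w Hw))
  (self z Hz) (self w Hw); intros G1 G2 G3 G4 L1 L2.
assert (Q1 : 0 < (1 - Cmod (phi z) ^ 2) / (1 - Cmod z ^ 2)) by (apply Rdiv_lt_0_compat; lra).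
assert (Q2 : 0 < (1 - Cmod (phi w) ^ 2) / (1 - Cmod w ^ 2)) by (apply Rdiv_lt_0_compat; lra).
assert (S1 := sqrt_lt_R0 _ Q1); assert (S2 := sqrt_lt_R0 _ Q2).
split.
- apply Rdiv_le_0_compat; [apply Rlt_le, Rdiv_lt_0_compat; auto|].
  apply Rmult_lt_0_compat; auto.
- unfold Rdiv at 1; rewrite Rpow_mult_distr, pow_inv, Rpow_mult_distr.
  rewrite !pow2_sqrt by lra; unfold sech2; field; repeat split; lra.
Qed.

Lemma coherence_radially_bounded :
  angular_liminf_gt0 coherence sigma -> radially_bounded phi sigma.
Proof.
intros HA; specialize (HA 2 ltac:(lra)).
apply filter_liminf_gt0 in HA; destruct HA as [V [y [HV [Hy HA]]]].
destruct HV as [Q1 Q2 H1 H2 HV].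
apply stolz_filter_eps in H1; destruct H1 as [d1 [Hd1 H1]].
apply stolz_filter_eps in H2; destruct H2 as [d2 [Hd2 H2]].
set (s := Rmax (/ 2) (1 - d2 / 2)).
generalize (Rmax_l (/ 2) (1 - d2 / 2)) (Rmax_r (/ 2) (1 - d2 / 2)); fold s; intros s1 s2.
assert (s3 : s < 1) by (apply Rmax_lub_lt; lra).
apply (sech2_radially_bounded phi sigma hphi hsigma s (/ y ^ 2) (Rmax 0 (1 - d1))).
- lra.
- split; [apply Rmax_l|apply Rmax_lub_lt; lra].
- intros r Hr; generalize (Rmax_l 0 (1 - d1)) (Rmax_r 0 (1 - d1)); intros.
  assert (Zr : Cmod (RtoC r * sigma)%C < 1) by (rewrite Cmod_radial by (auto; lra); lra).
  assert (Zs : Cmod (RtoC s * sigma)%C < 1) by (rewrite Cmod_radial by (auto; lra); lra).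
  assert (K : y <= coherence (RtoC r * sigma)%C (RtoC s * sigma)%C).
  { apply (HA (RtoC r * sigma, RtoC s * sigma)%C), HV.
    - apply H1; [apply radial_in_stolz; auto; lra|rewrite Cmod_radial_sub by (auto; lra); lra].
    - apply H2; [apply radial_in_stolz; auto; lra|rewrite Cmod_radial_sub by (auto; lra); lra]. }
  destruct (coherence_sech2 _ _ Zr Zs) as [_ E].
  assert (P := sech2_pos _ _ (self _ Zr) (self _ Zs)).
  set (q' := sech2 (phi (RtoC r * sigma)) (phi (RtoC s * sigma))) in *.
  set (q := sech2 (RtoC r * sigma)%C (RtoC s * sigma)%C) in *.
  assert (K2 : y ^ 2 <= q / q') by (rewrite <- E; apply pow_incr; lra).
  apply Rle_div_r in K2; [|exact P].
  apply Rmult_le_reg_l with (y ^ 2); [apply pow_lt, Hy|].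
  rewrite <- Rmult_assoc, Rinv_r, Rmult_1_l by (apply pow_nonzero; lra); exact K2.
Qed.

(** Schwarz-Pick against 0, with |1 - conj (phi 0) phi z| >= 1 - |phi 0|: the values of [phi] cannot
    approach the circle faster than a multiple of 1 - |z|. *)
Let schwarz_pick_at_0 z : Cmod z < 1 ->
  (1 - Cmod (phi 0)) ^ 2 * (1 - Cmod z) <= 2 * (1 - Cmod (phi z)).
Proof.
intros Hz.
assert (S := schwarz_pick phi z 0 (self_map_cdiff phi hphi) (self_map_lt1 phi hphi) Hz disc_pt0).
assert (P0 := self 0 disc_pt0); assert (Pz := self z Hz).
replace (1 - Cconj 0 * z)%C with (RtoC 1) in S
  by (unfold Cconj, RtoC, Cminus, Copp, Cmult, Cplus; simpl; f_equal; ring).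
rewrite Cmod_0, Cmod_1 in S.
assert (B : 1 - Cmod (phi 0) <= Cmod (1 - Cconj (phi 0) * phi z)%C).
{ generalize (Cmod_triangle (1 - Cconj (phi 0) * phi z)%C (Cconj (phi 0) * phi z)%C).
  replace (1 - Cconj (phi 0) * phi z + Cconj (phi 0) * phi z)%C with (RtoC 1) by ring.
  rewrite Cmod_1, Cmod_mult, Cmod_conj.
  generalize (Cmod_ge_0 (phi 0)) (Cmod_ge_0 (phi z)); nra. }
generalize (disc_gap z Hz) (disc_gap _ Pz) (disc_gap _ P0); intros G1 G2 G3.
set (m := Cmod (1 - Cconj (phi 0) * phi z)%C) in *.
assert (B2 : (1 - Cmod (phi 0)) ^ 2 <= m ^ 2) by (apply pow_incr; lra).
apply Rle_trans with (m ^ 2 * (1 - Cmod z ^ 2)).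
- apply Rmult_le_compat; [apply pow2_ge_0|lra|exact B2|lra].
- assert ((1 - Cmod (phi z) ^ 2) * (1 - Cmod (phi 0) ^ 2) <= (1 - Cmod (phi z) ^ 2) * 1).
  { apply Rmult_le_compat_l; [lra|]; generalize (pow2_ge_0 (Cmod (phi 0))); lra. }
  lra.
Qed.

(** The squared coherence is a product of three factors. The Lipschitz bound at [sigma] makes each
    (1 - |z|^2) / (1 - |phi z|^2) at least 1 / B. The third, the squared quotient of |1 - conj (phi
    w) phi z| by |1 - conj w z|, is at least 1 / D^2: in a Stolz region the denominator is at most M
    times the sum of the gaps 1 - |z| and 1 - |w|, and [schwarz_pick_at_0] passes from these gaps to
    those of the images. *)
Lemma conformal_coherence : conformal_strong phi sigma -> angular_liminf_gt0 coherence sigma.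
Proof.
intros [omega [Ho [l Hl]]] M HM; apply filter_liminf_gt0.
destruct (conformal_lipschitz phi sigma hsigma omega l M Hl HM) as [d [Hd HL]].
set (L := Cmod l + 1); assert (HL0 : 0 < L) by (unfold L; generalize (Cmod_ge_0 l); lra).
set (k := (1 - Cmod (phi 0)) ^ 2).
assert (Hk : 0 < k) by (apply pow_lt; generalize (self 0 disc_pt0); lra).
(* [L] is the Lipschitz constant, [M] converts |z - sigma| into 1 - |z|, and 2 passes from 1 - |phi
   z| to 1 - |phi z|^2. *)
set (B := 2 * (L * M)).
assert (HB : 0 < B) by (unfold B; generalize (Rmult_lt_0_compat L M HL0 ltac:(lra)); lra).
(* [2 / k] comes from [schwarz_pick_at_0]; the other 2 is from bounding the sum of the two gaps of
   the images by 2 |1 - conj (phi w) phi z|. *)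
set (D := 4 * M / k).
assert (HD : 0 < D) by (apply Rdiv_lt_0_compat; lra).
assert (HBD : 0 < B * D) by (apply Rmult_lt_0_compat; auto).
set (Q := fun z => stolz sigma M z /\ Cmod (z - sigma)%C < d).
assert (HQ : stolz_filter sigma M Q).
{ apply stolz_filter_eps; exists d; split; [exact Hd|]; unfold Q; auto. }
exists (fun p => Q (fst p) /\ Q (snd p)), (/ (B * D)).
split; [apply Filter_prod with (1 := HQ) (2 := HQ); simpl; auto|].
split; [apply Rinv_0_lt_compat, HBD|].
assert (Up : forall z, Q z -> 1 - Cmod (phi z) ^ 2 <= B * (1 - Cmod z ^ 2)).
{ intros z [[Hz Hs] Hdz]; specialize (HL z (conj Hz Hs) Hdz); fold L in HL.
  unfold in_disc in Hz; generalize (disc_gap z Hz) (disc_gap _ (self z Hz)); intros G1 G2.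
  assert (1 - Cmod (phi z) <= Cmod (phi z - omega)%C).
  { rewrite <- Ho; generalize (Cmod_triangle (phi z) (- (phi z - omega))%C).
    rewrite Cmod_opp; replace (phi z + - (phi z - omega))%C with omega by ring; lra. }
  assert (L * Cmod (z - sigma)%C <= L * (M * (1 - Cmod z))) by (apply Rmult_le_compat_l; lra).
  apply Rle_trans with (B * (1 - Cmod z)); [unfold B; lra|apply Rmult_le_compat_l; lra]. }
intros [z w] [Qz Qw]; simpl fst in *; simpl snd in *.
assert (U1 := Up z Qz); assert (U2 := Up w Qw).
destruct Qz as [[Hz Sz] _], Qw as [[Hw Sw] _]; unfold in_disc in Hz, Hw.
assert (Pz := self z Hz); assert (Pw := self w Hw).
destruct (coherence_sech2 z w Hz Hw) as [C0 C2].
assert (N1 := conj_mul_gap_pos z w Hz Hw); assert (N2 := conj_mul_gap_pos _ _ Pz Pw).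
generalize (disc_gap z Hz) (disc_gap w Hw) (disc_gap _ Pz) (disc_gap _ Pw); intros G1 G2 G3 G4.
assert (Gap : Cmod (1 - Cconj w * z)%C <= D * Cmod (1 - Cconj (phi w) * phi z)%C).
{ assert (A1 : Cmod (1 - Cconj w * z)%C <= M * ((1 - Cmod w) + (1 - Cmod z))).
  { eapply Rle_trans; [apply (one_minus_bound sigma hsigma); lra|].
    replace (sigma - w)%C with (- (w - sigma))%C by ring.
    replace (sigma - z)%C with (- (z - sigma))%C by ring; rewrite !Cmod_opp; lra. }
  assert (A2 : (1 - Cmod (phi w)) + (1 - Cmod (phi z))
    <= 2 * Cmod (1 - Cconj (phi w) * phi z)%C).
  { generalize (Cmod_triangle (1 - Cconj (phi w) * phi z)%C (Cconj (phi w) * phi z)%C).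
    replace (1 - Cconj (phi w) * phi z + Cconj (phi w) * phi z)%C with (RtoC 1) by ring.
    rewrite Cmod_1, Cmod_mult, Cmod_conj.
    generalize (Cmod_ge_0 (phi w)) (Cmod_ge_0 (phi z)); nra. }
  assert (A3 := schwarz_pick_at_0 z Hz); assert (A4 := schwarz_pick_at_0 w Hw).
  fold k in A3, A4.
  eapply Rle_trans; [exact A1|].
  apply Rmult_le_reg_l with k; [exact Hk|].
  replace (k * (D * Cmod (1 - Cconj (phi w) * phi z)%C))
    with (M * (4 * Cmod (1 - Cconj (phi w) * phi z)%C)) by (unfold D; field; lra).
  replace (k * (M * (1 - Cmod w + (1 - Cmod z))))
    with (M * (k * (1 - Cmod w) + k * (1 - Cmod z))) by ring.
  apply Rmult_le_compat_l; lra. }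
apply Rsqr_incr_0_var; [|exact C0].
rewrite !Rsqr_pow2.
rewrite C2, pow_inv.
assert (S := sech2_pos _ _ Pz Pw); assert (S' := sech2_pos z w Hz Hw).
apply Rle_div_r; [exact S|].
apply Rmult_le_reg_l with ((B * D) ^ 2); [apply pow_lt, HBD|].
rewrite <- Rmult_assoc, Rinv_r, Rmult_1_l by (apply pow_nonzero; lra).
unfold sech2.
set (m' := Cmod (1 - Cconj (phi w) * phi z)%C) in *.
set (m := Cmod (1 - Cconj w * z)%C) in *.
apply Rle_trans with ((B * (1 - Cmod z ^ 2)) * (B * (1 - Cmod w ^ 2)) / m' ^ 2).
- apply Rmult_le_compat_r; [apply Rlt_le, Rinv_0_lt_compat, pow_lt, N2|].
  apply Rmult_le_compat; lra.
- replace ((B * D) ^ 2 * ((1 - Cmod z ^ 2) * (1 - Cmod w ^ 2) / m ^ 2))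
    with (B * (1 - Cmod z ^ 2) * (B * (1 - Cmod w ^ 2)) * (D ^ 2 * / m ^ 2)) by (field; lra).
  apply Rmult_le_compat_l.
  + apply Rmult_le_pos; apply Rmult_le_pos; lra.
  + apply Rmult_le_reg_l with (m' ^ 2 * m ^ 2); [apply Rmult_lt_0_compat; apply pow_lt; auto|].
    replace (m' ^ 2 * m ^ 2 * / m' ^ 2) with (m ^ 2) by (field; lra).
    replace (m' ^ 2 * m ^ 2 * (D ^ 2 * / m ^ 2)) with ((D * m') ^ 2) by (field; lra).
    apply pow_incr; lra.
Qed.

End Kernel.

Theorem mainTheorem4 (phi : C -> C) (sigma : C)
    (hphi : holomorphic_self_map phi) (hsigma : Cmod sigma = 1) :
  (conformal_strong phi sigma <->
     filterlim
       (fun p : R * R =>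
          hyp_dist (RtoC (fst p) * sigma)%C (RtoC (snd p) * sigma)%C
          - hyp_dist (phi (RtoC (fst p) * sigma)%C)
                     (phi (RtoC (snd p) * sigma)%C))
       (filter_prod (within (fun r : R => 0 < r < 1) (locally 1))
                    (within (fun s : R => 0 < s < 1) (locally 1)))
       (locally 0))
  /\
  (forall H : hilbert_function_space unit_disc, is_dBR_space phi H ->
     (conformal_strong phi sigma <->
        angular_liminf_gt0
          (fun z w : C =>
             Cmod (inner H (dBR_kernel phi z) (dBR_kernel phi w))
             / (hnorm H (dBR_kernel phi z) * hnorm H (dBR_kernel phi w)))
          sigma)).
Proof.
split; [split|intros H hH; split].
- intros Hc; apply (radially_bounded_hyp_dist phi sigma hphi hsigma).
  apply conformal_radially_bounded; assumption.
- intros Hb; apply radially_bounded_conformal; auto.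
  apply (hyp_dist_radially_bounded phi sigma hphi hsigma Hb).
- apply (conformal_coherence phi sigma hphi hsigma H hH).
- intros Hc; apply radially_bounded_conformal; auto.
  apply (coherence_radially_bounded phi sigma hphi hsigma H hH Hc).
Qed.
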